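(* Let $q=p^m=ef+1$ be a prime power ($p$ prime) and consider the cyclotomic class $C_0^e$ in $GF(q)$. (i) Let $e=3$ and let $4q=c^2+27d^2$ with $c\equiv1\pmod3$ be the representation described below. Then $C_0^3$ is a partial difference set if and only if $d=0$. In this case its parameters are $(q,\frac{q-1}{3},\frac{q-8+c}{9},\frac{2q-4-c}{18})$ and $C_0^3$ is proper if non-trivial. This holds precisely when $p\equiv2\pmod3$ and $m$ is even. (ii) Let $e=4$ and let $q=s^2+4t^2$ with $s\equiv1\pmod4$ be the representation described below. Then $C_0^4$ is a partial difference set if and only if $t=0$. In this case its parameters are $(q,\frac{q-1}{4},\frac{q-11-6s}{16},\frac{q-3+2s}{16})$. This holds precisely when $p\equiv3\pmod4$ and $m$ is even. (iii) Let $e=6$ and let $q=s^2+3t^2$ with $s\equiv1\pmod3$ be the representation described below. Then $C_0^6$ is a partial difference set if and only if $t=0$. In this case its parameters are $(q,\frac{q-1}{6},\frac{q-17-20s}{36},\frac{q-5+4s}{36})$. This holds precisely when $p\equiv5\pmod6$ and $m$ is even. (iv) Let $e=8$ and let $q=x^2+4y^2=a^2+2b^2$ with $x\equiv a\equiv1\pmod4$ be the representations described below. Then $C_0^8$ is a partial difference set if and only if $x=a$ and $y=b=0$. In this case its parameters are $(q,\frac{q-1}{8},\frac{q-23-42x}{64},\frac{q-7+6x}{64})$. This holds precisely when $p\equiv7\pmod8$ and $m$ is even.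
   Context: $\alpha$ is a primitive element of $GF(q)$ and $C_0^e=\langle\alpha^e\rangle$. A subset $P\subseteq GF(q)$ of size $k$ is a $(q,k,\lambda,\mu)$-partial difference set (in the additive group, $G^*=GF(q)\setminus\{0\}$) if the multiset $\{x-y:x,y\in P,x\neq y\}$ equals $\lambda$ copies of $P$ together with $\mu$ copies of $G^*\setminus P$; it is proper if $\lambda\neq\mu$. The representations (''proper representations'') are: for $e=3$, if $p\equiv2\pmod3$ then $m$ is even, $d=0$ and $c=\pm2p^{m/2}$ with sign chosen so $c\equiv1\pmod3$, while if $p\equiv1\pmod3$, $4q=c^2+27d^2$ is the unique representation with $p\nmid c$ and $c\equiv1\pmod3$ ($d$ determined up to sign). For $e=4$, if $p\equiv3\pmod4$ then $s=(-p)^{m/2}$, $t=0$, while if $p\equiv1\pmod4$, $q=s^2+4t^2$ with $p\nmid s$, $s\equiv1\pmod4$. For $e=6$, if $p\equiv5\pmod6$ then $m$ is even, $t=0$ and $s=\pm p^{m/2}$ with $s\equiv1\pmod3$, while if $p\equiv1\pmod6$, $q=s^2+3t^2$ is the unique proper representation (with $p\nmid s$) with $s\equiv1\pmod3$. For $e=8$: $q=x^2+4y^2$, $x\equiv1\pmod4$, is the unique proper representation if $p\equiv1\pmod4$, otherwise $x=\pm p^{m/2}$ (with $x\equiv1\pmod4$) and $y=0$; $q=a^2+2b^2$, $a\equiv1\pmod4$, is the unique proper representation if $p\equiv1$ or $3\pmod8$, otherwise $a=\pm p^{m/2}$ (with $a\equiv1\pmod4$) and $b=0$.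
   Formalization: In (ii)-(iv) the ''if and only if'' is false for some difference sets (λ=μ), e.g. q=37 (e=4), q=7 (e=6), q=73 (e=8); so ''partial difference set'' is read as ''proper'' exactly when f is odd and s=1 (ii), when f=1 (iii), and when f is odd, x=-3 and a=1 (iv). *)

(* Defs.v *)
From HB Require Import structures.
From mathcomp Require Export all_boot all_order all_algebra.
From mathcomp Require Export all_fingroup all_solvable all_field.

Set Implicit Arguments.
Unset Strict Implicit.
Unset Printing Implicit Defensive.

Import GRing.Theory.

Local Open Scope ring_scope.

Section PartialDifferenceSets.

Variable G : finZmodType.
Implicit Type P : {set G}.

(* Multiplicity of g in the multiset {x - y : x, y \in P, x != y}. *)
Definition diff_mult P (g : G) : nat :=
  #|[set xy in setX P P | (xy.1 != xy.2) && (xy.1 - xy.2 == g)]|.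

(* Equality of multisets, multiplicity by multiplicity; each boolean is       *)
(* coerced to nat.                                                            *)
Definition pds P (v k lambda mu : nat) : Prop :=
  [/\ #|G| = v, #|P| = k
    & forall g : G, diff_mult P g =
        (lambda * (g \in P) + mu * ((g != 0%R) && (g \notin P)))%N].

Definition is_pds P : Prop :=
  exists v k lambda mu, pds P v k lambda mu.

(* A pds with lambda = mu is an ordinary difference set. For f = (q - 1) / e  *)
(* odd such sets do occur among the C_0^e: the singletons (f = 1), the        *)
(* quartic residues when q = 1 + 4 t^2 with t odd (e.g. q = 37), the octic    *)
(* residues when q = 9 + 4 y^2 = 1 + 2 b^2 (e.g. q = 73).                     *)
Definition is_proper_pds P : Prop :=
  exists v k lambda mu, pds P v k lambda mu /\ lambda <> mu.

(* Ma's notion of triviality: the Cayley graph of P is a disjoint union of    *)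
(* complete graphs or a complete multipartite graph.                          *)
Definition trivial_pds P : Prop :=
  GRing.zmod_closed (0 |: P) \/ GRing.zmod_closed (~: P).

End PartialDifferenceSets.

Definition primitive_element (F : finFieldType) (alpha : {unit F}) : Prop :=
  generator [set: {unit F}] alpha.

Definition cyclotomic_class0 (F : finFieldType) (alpha : {unit F}) (e : nat) :
    {set F} :=
  [set FinRing.uval u | u in <[alpha ^+ e]>%g].

(* In the representations below q = p ^ m. Where m./2 occurs, m is even       *)
(* because q = 1 mod e.                                                       *)

Definition rep3 (p m : nat) (c d : int) : Prop :=
  [/\ (p %% 3 = 2)%N ->
        [/\ d = 0, c = 2 * p%:Z ^+ m./2 \/ c = - (2 * p%:Z ^+ m./2)
          & (c = 1 %[mod 3])%Z]
    & (p %% 3 = 1)%N ->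
        [/\ 4 * p%:Z ^+ m = c ^+ 2 + 27 * d ^+ 2, ~~ (p%:Z %| c)%Z
          & (c = 1 %[mod 3])%Z]].

Definition rep4 (p m : nat) (s t : int) : Prop :=
  [/\ (p %% 4 = 3)%N -> s = (- p%:Z) ^+ m./2 /\ t = 0
    & (p %% 4 = 1)%N ->
        [/\ p%:Z ^+ m = s ^+ 2 + 4 * t ^+ 2, ~~ (p%:Z %| s)%Z
          & (s = 1 %[mod 4])%Z]].

Definition rep6 (p m : nat) (s t : int) : Prop :=
  [/\ (p %% 6 = 5)%N ->
        [/\ t = 0, s = p%:Z ^+ m./2 \/ s = - p%:Z ^+ m./2
          & (s = 1 %[mod 3])%Z]
    & (p %% 6 = 1)%N ->
        [/\ p%:Z ^+ m = s ^+ 2 + 3 * t ^+ 2, ~~ (p%:Z %| s)%Z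
          & (s = 1 %[mod 3])%Z]].

Definition rep8_xy (p m : nat) (x y : int) : Prop :=
  (x = 1 %[mod 4])%Z /\
  if (p %% 4 == 1)%N
  then p%:Z ^+ m = x ^+ 2 + 4 * y ^+ 2 /\ ~~ (p%:Z %| x)%Z
  else (x = p%:Z ^+ m./2 \/ x = - p%:Z ^+ m./2) /\ y = 0.

Definition rep8_ab (p m : nat) (a b : int) : Prop :=
  (a = 1 %[mod 4])%Z /\
  if ((p %% 8 == 1) || (p %% 8 == 3))%N
  then p%:Z ^+ m = a ^+ 2 + 2 * b ^+ 2 /\ ~~ (p%:Z %| a)%Z
  else (a = p%:Z ^+ m./2 \/ a = - p%:Z ^+ m./2) /\ b = 0.

(* Main.v *)
Require Import Defs.
From mathcomp Require Import zify ring.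
Import Order.TTheory GRing.Theory Num.Theory.
Local Open Scope ring_scope.

Set Implicit Arguments.
Unset Strict Implicit.
Unset Printing Implicit Defensive.

(** Let [chi_j] be the characters of order dividing [e] of the multiplicative
    group and [J(i, j)] their Jacobi sums.  The class [C] is a partial
    difference set if and only if [S_j = \sum_k J(k, j)] does not depend on
    [j <> 0 mod e], and then [S_j = e (lambda - mu)].

    If [p = -1 mod e], the Frobenius map identifies [J(i, j)] with its
    conjugate, so [J(i, j) = +- sqrt q].  The classical relations between Jacobi
    sums make them all equal, up to one sign for [e = 8], and the signs are
    forced by the integrality of the multiplicities.

    Otherwise, if [-1 \in C], the same computation with the characters
    [x ^+ (j f)] with values in [F] itself shows that a partial difference set
    would force [p] to divide ['C(2 f, f)] (['C(3 f, f)] if [e = 8] and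
    [p = 5 mod 8]), whereas [f + f] (resp. [f + 2 f]) has no carry in base [p].
    If [-1 \notin C] then [lambda = mu] and all the [S_j] vanish.  Solving these
    equations gives [q = 1 + 4 t ^ 2] for [e = 4], [q = 7] for [e = 6], and
    [q = 9 + 4 y ^ 2 = 1 + 2 b ^ 2] for [e = 8]; the representations being
    unique, these are the improper cases excluded by the statement. *)

(** * Cyclotomic classes *)

(** For [g != 0], the multiplicity of [g] among the differences of [C] depends only on the coset
    [g C], so it is a combination of the chi_j; the indicator function of [C] has equal coefficients
    at all chi_j. This is why only the nontrivial S_j have to be compared.

    When the representation of [q] is a proper one, [p] not dividing its first coordinate already
    makes the second one nonzero; what remains is to refute the partial difference set property.
    With values in [F] this is cheap: summing [z ^+ i] over [C] kills every exponent not divisible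
    by [f], leaving binomial coefficients. For [-1 \notin C] the equation for [j = 2] no longer
    makes [p] divide ['C(2 f, f)], hence the return to complex Jacobi sums.

    Carries are read from [f mod p^k = (s p^k - 1) / e], where [s p^k = 1] modulo [e]. If
    [p = 3 mod 8], [s] is 1 or 3 and doubling is harmless. If [p = 5 mod 8], [s] is 1 or 5: [f + f]
    carries, but [5/8 + 2/8 < 1], hence [f + 2 f]. If [p = -1 mod e], [s = e - 1] occurs and [f + f]
    carries. *)

Section PrimitiveElement.

Variables (F : finFieldType) (alpha : {unit F}).
Hypothesis alpha_prim : primitive_element alpha.

Local Notation a := (FinRing.uval alpha).

Lemma primitive_order : #[alpha]%g = #|F|.-1.
Proof.
by rewrite -card_finField_unit orderE; move/eqP: alpha_prim => <-.
Qed.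

Lemma card_pred_gt0 : (0 < #|F|.-1)%N.
Proof. by rewrite -primitive_order order_gt0. Qed.

Lemma val_expg i : FinRing.uval (alpha ^+ i)%g = a ^+ i.
Proof. exact: FinRing.val_unitX. Qed.

Lemma prim_neq0 : a != 0.
Proof. by rewrite -unitfE; case: alpha. Qed.

Lemma prim_expr_eq i j : (a ^+ i == a ^+ j) = (i == j %[mod #|F|.-1]).
Proof.
by rewrite -!val_expg (inj_eq val_inj) eq_expg_mod_order primitive_order.
Qed.

Lemma prim_exp_surj x : x != 0 -> exists i : 'I_(#|F|.-1), x = a ^+ i.
Proof.
move=> x0; have ux : x \is a GRing.unit by rewrite unitfE.
have : FinRing.Unit ux \in <[alpha]>%g by rewrite -(eqP alpha_prim) inE.
case/cyclePmin => i; rewrite primitive_order => li E; exists (Ordinal li).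
by rewrite -val_expg -E.
Qed.

(** Discrete logarithm to base [alpha], with the junk value 0 at [x = 0]. *)
Definition dlog (x : F) : nat :=
  odflt 0%N (omap val [pick i : 'I_(#|F|.-1) | x == a ^+ i]).

Lemma dlogK x : x != 0 -> a ^+ dlog x = x.
Proof.
move=> x0; rewrite /dlog; case: pickP => [i /eqP -> //|].
by have [i ->] := prim_exp_surj x0 => /(_ i); rewrite eqxx.
Qed.

Lemma dlog_expr i : dlog (a ^+ i) = i %[mod #|F|.-1].
Proof. by apply/eqP; rewrite -prim_expr_eq dlogK // expf_neq0 // prim_neq0. Qed.

Section Class.

Variables (e f : nat).
Hypothesis cardF : #|F|.-1 = (e * f)%N.

Local Notation C := (cyclotomic_class0 alpha e).

Lemma classP x : reflect (exists k, x = a ^+ (e * k)) (x \in C).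
Proof.
apply: (iffP imsetP) => [[u /cycleP[k ->] ->]|[k ->]].
  by exists k; rewrite -expgM val_expg.
by exists (alpha ^+ e ^+ k)%g; rewrite ?mem_cycle // -expgM val_expg.
Qed.

Lemma e_gt0 : (0 < e)%N.
Proof. by have := card_pred_gt0; rewrite cardF muln_gt0 => /andP[]. Qed.

Lemma f_gt0 : (0 < f)%N.
Proof. by have := card_pred_gt0; rewrite cardF muln_gt0 => /andP[]. Qed.

Lemma card_class : #|C| = f.
Proof.
rewrite card_imset; last exact: val_inj.
have := orderE (alpha ^+ e)%g => <-.
rewrite orderXdiv primitive_order cardF ?dvdn_mulr //.
by rewrite mulKn ?e_gt0.
Qed.

Lemma class_neq0 x : x \in C -> x != 0.
Proof. by case/classP => k ->; rewrite expf_neq0 // prim_neq0. Qed.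

Lemma class1 : 1 \in C.
Proof. by apply/classP; exists 0%N; rewrite muln0. Qed.

Lemma classM x y : x \in C -> y \in C -> x * y \in C.
Proof.
move=> /classP[k ->] /classP[l ->]; apply/classP; exists (k + l)%N.
by rewrite -exprD mulnDr.
Qed.

Lemma prim_exp_card : a ^+ #|F|.-1 = 1.
Proof. by apply/eqP; rewrite -(expr0 a) prim_expr_eq modnn mod0n. Qed.

Lemma classV x : x \in C -> x^-1 \in C.
Proof.
move=> /classP[k ->]; apply/classP; exists (k * f.-1)%N.
have a0 := prim_neq0; apply: (mulfI (expf_neq0 (e * k) a0)).
rewrite divff ?expf_neq0 // -exprD.
have -> : (e * k + e * (k * f.-1) = #|F|.-1 * k)%N.
  by rewrite cardF; have := f_gt0; case: f => // f' _ /=; nia.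
by rewrite exprM prim_exp_card expr1n.
Qed.

Lemma class_expr x : x \in C -> x ^+ f = 1.
Proof. by case/classP => k ->; rewrite -exprM mulnAC -cardF exprM prim_exp_card
  expr1n. Qed.

Lemma class_dlog x : (x \in C) = (x != 0) && (e %| dlog x)%N.
Proof.
apply/classP/andP => [[k ->]|[x0 /dvdnP[k E]]]; last first.
  by exists k; rewrite mulnC -E dlogK.
split; first by rewrite expf_neq0 // prim_neq0.
have := dlog_expr (e * k); rewrite cardF => /(congr1 (modn^~ e)).
rewrite !modn_dvdm ?dvdn_mulr // /dvdn => ->.
by rewrite modnMr.
Qed.

Lemma prim_notin_class : (1 < e)%N -> a \notin C.
Proof.
move=> e1; apply/classP => -[k /eqP]; rewrite -{1}(expr1 a) prim_expr_eq cardF.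
move=> /eqP /(congr1 (modn^~ e)); rewrite !modn_dvdm ?dvdn_mulr //.
by rewrite modnMr modn_small.
Qed.

(** [psi 0 = 0] discards the diagonal [x = y], which the double sum includes and [diff_mult] leaves
    out. *)
Lemma sum_class_diff (R : comNzRingType) (psi : F -> R) :
    psi 0 = 0 ->
  \sum_(x in C) \sum_(y in C) psi (x - y)
     = \sum_g (diff_mult C g)%:R * psi g.
Proof.
move=> psi0.
rewrite pair_big_dep /=.
rewrite (partition_big (fun xy : F * F => xy.1 - xy.2) predT) //=.
apply: eq_bigr => g _.
rewrite (eq_bigr (fun _ => psi g)); last by move=> xy /andP[_ /eqP ->].
have [->|g0] := eqVneq g 0; first by rewrite psi0 big1 ?mulr0.
rewrite sumr_const mulr_natl /diff_mult; congr (_ *+ _); apply: eq_card => xy.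
rewrite !inE unfold_in; apply/idP/idP.
  case/andP=> /andP[-> ->] /eqP E /=; rewrite E eqxx andbT.
  by rewrite -subr_eq0 E.
by case/andP => /andP[-> ->] /andP[_ ->].
Qed.

Lemma sum_class_mul (R : nmodType) (h : F -> R) x : x \in C ->
  \sum_(y in C) h (x * y) = \sum_(y in C) h y.
Proof.
move=> xC; have x0 := class_neq0 xC.
rewrite [RHS](reindex_inj (mulfI x0)) /=; apply: eq_bigl => y.
apply/idP/idP => yC; first exact: classM.
by rewrite -(mulKf x0 y) classM // classV.
Qed.

(** The sum of [psi (x - y)] over pairs of [C] is evaluated twice: factoring out [x] gives [f]
    copies of the left-hand side, and grouping by differences gives [f (l - mu)], since [psi] sums
    to 0 over [F]. The target field is general because both complex characters and characters with
    values in [F] are substituted for [psi]. *)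
Lemma pds_char_sum (R : fieldType) (psi : F -> R) v k l mu :
    pds C v k l mu ->
    psi 0 = 0 -> {morph psi : x y / x * y} -> {in C, forall x, psi x = 1} ->
    \sum_x psi x = 0 -> f%:R != 0 :> R ->
  \sum_(z in C) psi (1 - z) = l%:R - mu%:R.
Proof.
move=> [_ _ dE] psi0 psiM psiC psis f0; apply: (mulfI f0).
have L : \sum_(x in C) \sum_(y in C) psi (x - y)
   = f%:R * \sum_(z in C) psi (1 - z).
  rewrite (eq_bigr (fun _ => \sum_(z in C) psi (1 - z))).
    by rewrite sumr_const card_class mulr_natl.
  move=> x xC; rewrite -(sum_class_mul (fun y => psi (x - y)) xC).
  apply: eq_bigr => y yC.
  by rewrite -{1}(mulr1 x) -mulrBr psiM psiC // mul1r.
rewrite -L (sum_class_diff psi0).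
rewrite (eq_bigr (fun g => (l%:R - mu%:R) * (if g \in C then psi g else 0) + mu%:R *
  psi g)).
  rewrite big_split /= -!mulr_sumr psis mulr0 addr0.
  by rewrite -big_mkcond (eq_bigr _ psiC) sumr_const card_class mulrC.
move=> g _; rewrite dE; have [->|g0] := eqVneq g 0.
  by rewrite psi0 if_same !mulr0 addr0.
case: (g \in C); rewrite /= ?muln1 ?muln0 ?addn0 ?add0n.
  by rewrite -mulrDl subrK.
by rewrite mulr0 add0r.
Qed.

End Class.
End PrimitiveElement.

(** * The obstruction modulo p *)

(** A common range of summation lets the Legendre formulas for the three factorials of a binomial
    coefficient be compared term by term. *)
Lemma logn_fact_wide p n N : prime p -> (n <= N)%N ->
  logn p n`! = (\sum_(1 <= k < N.+1) n %/ p ^ k)%N.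
Proof.
move=> pp le_nN; rewrite logn_fact // [RHS](@big_cat_nat _ _ _ n.+1) //=.
rewrite [X in (_ + X)%N]big_nat_cond [X in (_ + X)%N]big1 ?addn0 // => k.
rewrite andbT => /andP[nk _]; rewrite divn_small //.
by rewrite (leq_trans nk) // ltnW // ltn_expl // prime_gt1.
Qed.

(* Kummer's theorem, in the case of an addition without carries. *)
Lemma no_carry_bin p a b : prime p ->
    (forall k, (0 < k)%N -> (a %% p ^ k + b %% p ^ k < p ^ k)%N) ->
  ~~ (p %| 'C(a + b, a))%N.
Proof.
move=> pp nc; have := bin_fact (leq_addr b a); rewrite addKn.
move/(congr1 (logn p)).
have C0 : (0 < 'C(a + b, a))%N by rewrite bin_gt0 leq_addr.
rewrite lognM ?muln_gt0 ?fact_gt0 // lognM ?fact_gt0 //.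
rewrite (logn_fact_wide pp (leq_addr b a)) (logn_fact_wide pp (leq_addl a b)).
rewrite (logn_fact_wide pp (leqnn (a + b))) -big_split /=.
rewrite [RHS]big_nat [X in (_ + X)%N]big_nat.
rewrite [RHS](eq_bigr (fun k => a %/ p ^ k + b %/ p ^ k)%N); last first.
  move=> k /andP[k0 _]; rewrite divnD ?expn_gt0 ?prime_gt0 //.
  by rewrite leqNgt nc // addn0.
move/eqP; rewrite -[X in _ == X]add0n eqn_add2r.
rewrite lognE pp C0 /=; by case: (_ %| _)%N.
Qed.

Lemma big_dvdn_ord (R : zmodType) (G : nat -> R) f j : (0 < f)%N ->
  \sum_(i < (j * f).+1) (if (f %| i)%N then G i else 0)
    = \sum_(l < j.+1) G (l * f)%N.
Proof.
move=> f0; rewrite -(big_mkord xpredT (fun i => if (f %| i)%N then G i else 0)).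
rewrite -(big_mkord xpredT (fun l => G (l * f)%N)); elim: j => [|j IH].
  by rewrite mul0n !big_nat1 dvdn0 mul0n.
rewrite [RHS]big_nat_recr //= -IH (@big_cat_nat _ _ _ (j * f).+1) //=; last first.
  by rewrite ltnS leq_mul2r leqnSn orbT.
congr (_ + _); rewrite mulSn addnC -(prednK f0) addnS.
rewrite big_nat_recr ?leq_addr //= prednK // -addnS prednK //.
rewrite dvdn_addl // dvdn_mull // big_nat big1 ?add0r // => i /andP[i1 i2].
rewrite ifF //; apply/negP => /dvdnP[k E]; subst i.
have : (j < k)%N by rewrite -(ltn_pmul2r f0).
by move=> jk; nia.
Qed.

Lemma sum_mul_morph0 (F : finFieldType) (R : idomainType) (psi : F -> R) b :
  {morph psi : x y / x * y} -> b != 0 -> psi b != 1 -> \sum_x psi x = 0.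
Proof.
move=> psiM b0 b1; apply/eqP.
have : psi b * \sum_x psi x == \sum_x psi x.
  rewrite mulr_sumr [X in _ == X](reindex_inj (mulfI b0)) /=.
  by apply/eqP; apply: eq_bigr => x _; rewrite psiM.
by rewrite -subr_eq0 -{2}(mul1r (\sum_x _)) -mulrBl mulf_eq0 subr_eq0 (negPf b1).
Qed.

Section ModP.

Variables (F : finFieldType) (alpha : {unit F}).
Hypothesis alpha_prim : primitive_element alpha.
Variables (e f : nat).
Hypothesis cardF : #|F|.-1 = (e * f)%N.

Local Notation a := (FinRing.uval alpha).
Local Notation C := (cyclotomic_class0 alpha e).

Lemma natr_class_card : e%:R * f%:R = -1 :> F.
Proof.
rewrite -natrM -cardF -subn1 natrB ?(ltnW (finNzRing_gt1 F)) //.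
suff -> : #|F|%:R = 0 :> F by rewrite sub0r.
(* Translation by 1 leaves the sum of all elements of [F] unchanged, so [#|F|] vanishes in [F]. *)
apply: (addrI (\sum_(x : F) x)); rewrite addr0.
rewrite [RHS](reindex_inj (addIr 1)) /= big_split /=.
by rewrite sumr_const cardT -cardE.
Qed.

Lemma f_neq0 : f%:R != 0 :> F.
Proof.
apply/eqP => f0; have := natr_class_card; rewrite f0 mulr0 => /eqP.
by rewrite eq_sym oppr_eq0 oner_eq0.
Qed.

Lemma sum_class_exp i :
  \sum_(z in C) z ^+ i = if (f %| i)%N then f%:R else 0 :> F.
Proof.
case: ifP => [/dvdnP[k ->]|fi].
  rewrite (eq_bigr (fun _ => 1)); last first.
    by move=> z zC; rewrite mulnC exprM (class_expr alpha_prim cardF zC) expr1n.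
  by rewrite sumr_const (card_class alpha_prim cardF).
have cC : a ^+ e \in C by apply/classP; exists 1%N; rewrite muln1.
have := sum_class_mul alpha_prim cardF (fun z => z ^+ i) cC => /eqP.
under eq_bigr do rewrite exprMn.
rewrite -mulr_sumr -subr_eq0 -{2}(mul1r (\sum_(z in C) _)) -mulrBl mulf_eq0.
case/orP => [|/eqP //]; rewrite subr_eq0 -exprM -(expr0 a).
rewrite (prim_expr_eq alpha_prim) cardF mod0n -/(dvdn _ _).
by rewrite dvdn_pmul2l ?(e_gt0 alpha_prim cardF) // fi.
Qed.

Lemma sum_class_binomial j :
  \sum_(z in C) (1 - z) ^+ (j * f) =
    f%:R * \sum_(l < j.+1) (-1) ^+ (l * f) * 'C(j * f, l * f)%:R :> F.
Proof.
under eq_bigr do rewrite exprBn.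
rewrite exchange_big /=.
rewrite -(big_dvdn_ord (fun i => (-1) ^+ i * 'C(j * f, i)%:R)) ?(f_gt0 alpha_prim
  cardF) //.
rewrite mulr_sumr; apply: eq_bigr => i _.
under eq_bigr do rewrite expr1n mulr1 -mulr_natr.
under eq_bigr do rewrite mulrAC.
rewrite -mulr_sumr sum_class_exp; case: ifP; rewrite ?mulr0 //.
by rewrite mulrC.
Qed.

(** The character is [x ^+ (j * f)], nontrivial for [0 < j < e]. As [e f = -1] in [F], the factor
    [f] produced by the sum over [C] becomes [- e] on the right-hand side. *)
Lemma pds_binomial v k l mu j : pds C v k l mu -> (0 < j < e)%N ->
  \sum_(i < j.+1) (-1) ^+ (i * f) * 'C(j * f, i * f)%:R
    = e%:R * (mu%:R - l%:R) :> F.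
Proof.
move=> P /andP[j0 je].
have f0 := f_neq0.
have fn : (0 < j * f)%N by rewrite muln_gt0 j0 (f_gt0 alpha_prim cardF).
have := pds_char_sum alpha_prim cardF (psi := fun x : F => x ^+ (j * f)) P.
rewrite sum_class_binomial => H.
have ef := natr_class_card.
have -> : mu%:R - l%:R = - (l%:R - mu%:R) :> F by rewrite opprB.
rewrite -H // ?mulrN ?mulrA ?ef ?mulN1r ?opprK //.
- by rewrite expr0n -leqn0 leqNgt fn.
- by move=> x y; rewrite exprMn.
- by move=> x xC; rewrite mulnC exprM (class_expr alpha_prim cardF xC) expr1n.
- apply: (@sum_mul_morph0 _ _ _ a); rewrite ?(prim_neq0) //.
    by move=> x y; rewrite exprMn.
  rewrite -(expr0 a) (prim_expr_eq alpha_prim) cardF mod0n modn_small.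
    by rewrite -lt0n.
  by rewrite ltn_mul2r je (f_gt0 alpha_prim cardF).
Qed.

(** When [(-1) ^+ f = 1] the binomial sum is [2] for [j = 1] and [2 + 'C(2 f, f)] for [j = 2], and
    the two values agree. *)
Lemma pds_bin2 v k l mu : pds C v k l mu -> (2 < e)%N -> (-1) ^+ f = 1 :> F ->
  'C(2 * f, f)%:R = 0 :> F.
Proof.
move=> P e2 sf.
have := pds_binomial P (j := 2); have := pds_binomial P (j := 1).
rewrite e2 (ltnW e2) => <- // => /(_ isT).
rewrite !big_ord_recr !big_ord0 /= !mul0n !mul1n !bin0 !binn !(mulnC _ f) !exprM.
rewrite sf !expr1n !expr0 !add0r !mul1r => /eqP.
by rewrite -subr_eq0 => /eqP <-; ring.
Qed.

(** For [j = 3] the two inner binomial coefficients are equal, whence the factor 2. *)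
Lemma pds_bin3 v k l mu : pds C v k l mu -> (3 < e)%N -> (-1) ^+ f = 1 :> F ->
  2 * 'C(3 * f, f)%:R = 0 :> F.
Proof.
move=> P e3 sf.
have := pds_binomial P (j := 3); have := pds_binomial P (j := 1).
rewrite e3 (ltnW (ltnW e3)) => <- // => /(_ isT).
rewrite !big_ord_recr !big_ord0 /= !mul0n !mul1n !bin0 !binn.
have -> : 'C(3 * f, 2 * f) = 'C(3 * f, f).
  by rewrite -bin_sub ?leq_mul2r ?orbT //; congr 'C(_, _); lia.
rewrite !(mulnC _ f) !exprM sf !expr1n !expr0 !add0r !mul1r => /eqP.
rewrite -subr_eq0 => /eqP <-; ring.
Qed.

End ModP.

(** * Residues of f modulo powers of p, and carries *)

Lemma mod_pexp_residue p m e f k : prime p -> (e * f + 1 = p ^ m)%N ->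
  (0 < e)%N -> (k <= m)%N ->
  exists2 s, (e * (f %% p ^ k) + 1 = s * p ^ k)%N & (0 < s <= e)%N.
Proof.
move=> pp E e0 km.
have pk0 : (0 < p ^ k)%N by rewrite expn_gt0 prime_gt0.
have : (p ^ k %| e * f + 1)%N by rewrite E dvdn_exp2l.
rewrite {1}(divn_eq f (p ^ k)) mulnDr -addnA dvdn_addr; last first.
  by rewrite mulnA dvdn_mull.
case/dvdnP => s Es; exists s => //.
have lt := ltn_pmod f pk0.
move: Es lt; set r := (f %% _)%N; set P := (p ^ k)%N in pk0 *.
by move=> Es lt; apply/andP; split; nia.
Qed.

(** Up to [k = m] the residue is [(s p^k - 1) / e]; beyond, [f] itself is already below
    [p^k / e]. *)
Lemma modn_residue_cases p m e f : prime p -> (e * f + 1 = p ^ m)%N ->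
  (0 < e)%N -> forall k,
  (e * (f %% p ^ k) < p ^ k)%N \/
  exists2 s, (e * (f %% p ^ k) + 1 = s * p ^ k)%N & (0 < s <= e)%N.
Proof.
move=> pp E e0 k; case: (leqP k m) => km.
  by right; apply: (@mod_pexp_residue p m).
left; have : (p ^ m < p ^ k)%N by rewrite ltn_exp2l // prime_gt1.
rewrite -E => H; have := leq_mod f (p ^ k); nia.
Qed.

Lemma ndvd_bin2_mod1 p m e f : prime p -> (e * f + 1 = p ^ m)%N -> (2 <= e)%N ->
  (p %% e = 1)%N -> ~~ (p %| 'C(2 * f, f))%N.
Proof.
move=> pp E e2 p1; rewrite mul2n -addnn; apply: no_carry_bin => // k k0.
have [H|[s Es /andP[s0 se]]] := modn_residue_cases pp E (ltnW e2) k; first by nia.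
(* Since [p = 1] modulo [e], so is [s]; the residue is [(p^k - 1) / e], less than half of [p^k]. *)
suff s1 : s = 1%N by rewrite s1 in Es; nia.
have : (s * p ^ k = 1 %[mod e])%N.
  by rewrite -Es -modnDml modnMr.
rewrite -modnMmr -modnXm p1 exp1n modnMmr muln1 (modn_small e2).
case: (ltngtP s e) se => // [lt _|-> _].
  by rewrite modn_small.
by rewrite modnn.
Qed.

Lemma exp_mod8_odd p m : odd p -> (p ^ m %% 8 = if odd m then p %% 8 else 1)%N.
Proof.
move=> op; elim: m => [|m IH] //.
rewrite expnS -modnMm IH /=; case: (odd m) => /=; last by rewrite muln1 modn_mod.
have := ltn_pmod p (isT : 0 < 8)%N.
have : odd (p %% 8) by rewrite odd_mod.
by move: (p %% 8)%N => r; do 8 (case: r => // r).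
Qed.

(** [p^k] is 1 or 3 modulo 8, each its own inverse, so [s] is 1 or 3 and the residue stays below
    [3/8] of [p^k]. *)
Lemma ndvd_bin2_mod8 p m f : prime p -> (8 * f + 1 = p ^ m)%N ->
  (p %% 8 = 3)%N -> ~~ (p %| 'C(2 * f, f))%N.
Proof.
move=> pp E p3; rewrite mul2n -addnn; apply: no_carry_bin => // k k0.
have [H|[s Es /andP[s0 se]]] := modn_residue_cases pp E (isT : 0 < 8)%N k; first by nia.
have op : odd p by lia.
suff : (s = 1 \/ s = 3)%N by case=> s1; rewrite s1 in Es; lia.
have := exp_mod8_odd k op; rewrite p3; case: (odd k); move: Es; set r := (f %% _)%N;
  set P := (p ^ k)%N;
  move=> Es PE; by do 9 (case: s s0 se Es => [|s] s0 se Es //; try lia).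
Qed.

Lemma ndvd_bin3_mod8 p m f : prime p -> (8 * f + 1 = p ^ m)%N ->
  (p %% 8 = 5)%N -> ~~ (p %| 'C(3 * f, f))%N.
Proof.
move=> pp E p3; rewrite (mulnDl 1 2) mul1n; apply: no_carry_bin => // k k0.
rewrite -modnMmr.
have [H|[s Es /andP[s0 se]]] := modn_residue_cases pp E (isT : 0 < 8)%N k.
  by rewrite (modn_small (m := 2 * _)); lia.
have op : odd p by lia.
suff : (s = 1 \/ s = 5)%N.
  move: Es; set r := (f %% _)%N; set P := (p ^ k)%N.
  move=> Es [] s1; rewrite s1 in Es; first by rewrite (modn_small (m := 2 * _)); lia.
  (* For [s = 5], [2 r] wraps around once and leaves [(P - 1) / 4], which still fits next to
     [r = (5 P - 1) / 8]. *)
  have -> : (2 * r = 2 * r - P + P)%N by lia.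
  by rewrite modnDr modn_small; lia.
have := exp_mod8_odd k op; rewrite p3; case: (odd k); move: Es; set r := (f %% _)%N;
  set P := (p ^ k)%N;
  move=> Es PE; by do 9 (case: s s0 se Es => [|s] s0 se Es //; try lia).
Qed.

(** * Jacobi sums *)

Section Convolution.

Variables (G : finZmodType) (R : comNzRingType).

Definition conv (u v : G -> R) (x : G) : R := \sum_y u y * v (x - y).

(** Evaluated at 1 on three characters, this is the source of the product relations [jacobi_assoc]
    and [jacobi_norm]. *)
Lemma convA (u v w : G -> R) x :
  conv (conv u v) w x = conv u (conv v w) x.
Proof.
rewrite /conv; under eq_bigr do rewrite mulr_suml.
rewrite exchange_big /=; apply: eq_bigr => z _.
rewrite mulr_sumr (reindex_inj (addIr z)) /=; apply: eq_bigr => y _.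
by rewrite addrK -mulrA opprD addrA addrAC.
Qed.

End Convolution.

Section Characters.

Variables (F : finFieldType) (alpha : {unit F}).
Hypothesis alpha_prim : primitive_element alpha.
Variables (e f : nat).
Hypothesis cardF : #|F|.-1 = (e * f)%N.
Variables (R : numFieldType) (zeta : R).
Hypothesis zeta_prim : e.-primitive_root zeta.

Local Notation a := (FinRing.uval alpha).
Local Notation C := (cyclotomic_class0 alpha e).

(** Every chi_j vanishes at 0, even for [j = 0]: the trivial character is the indicator function of
    the nonzero elements. Indices are natural numbers that matter only modulo [e]. *)
Definition chi (j : nat) (x : F) : R :=
  if x == 0 then 0 else zeta ^+ (j * dlog alpha x).

Lemma zeta_expr_eq i j : i = j %[mod e] -> zeta ^+ i = zeta ^+ j.
Proof. by move=> E; apply/eqP; rewrite (eq_prim_root_expr zeta_prim) E. Qed.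

Lemma chi0 j : chi j 0 = 0. Proof. by rewrite /chi eqxx. Qed.

Lemma chi_exp j i : chi j (a ^+ i) = zeta ^+ (j * i).
Proof.
rewrite /chi (negPf (expf_neq0 _ (prim_neq0 _))); apply: zeta_expr_eq.
rewrite -modnMmr -[RHS]modnMmr; congr ((_ * _) %% _)%N.
have := dlog_expr alpha_prim i; rewrite cardF => /(congr1 (modn^~ e)).
by rewrite !modn_dvdm ?dvdn_mulr.
Qed.

Lemma chi_neq0 j x : x != 0 -> chi j x != 0.
Proof.
move=> x0; rewrite /chi (negPf x0) expf_neq0 //.
apply: contra_eq_neq (prim_expr_order zeta_prim) => ->.
by rewrite expr0n -leqn0 leqNgt (prim_order_gt0 zeta_prim) /= eq_sym oner_eq0.
Qed.

Lemma chiM j : {morph chi j : x y / x * y}.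
Proof.
move=> x y; have [->|x0] := eqVneq x 0; first by rewrite mul0r chi0 mul0r.
have [->|y0] := eqVneq y 0; first by rewrite mulr0 chi0 mulr0.
have [i ->] := prim_exp_surj alpha_prim x0.
have [k ->] := prim_exp_surj alpha_prim y0.
by rewrite -exprD !chi_exp mulnDr exprD.
Qed.

Lemma chi1 j : chi j 1 = 1.
Proof. by rewrite -(expr0 a) chi_exp muln0. Qed.

Lemma chiV j x : chi j x^-1 = (chi j x)^-1.
Proof.
have [->|x0] := eqVneq x 0; first by rewrite invr0 chi0 invr0.
by apply: (mulfI (chi_neq0 j x0)); rewrite divff ?chi_neq0 // -chiM divff // chi1.
Qed.

Lemma chiD i j x : chi (i + j) x = chi i x * chi j x.
Proof.
by rewrite /chi; case: eqP => _; rewrite ?mul0r // mulnDl exprD.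
Qed.

Lemma chi_mod i j x : i = j %[mod e] -> chi i x = chi j x.
Proof.
move=> E; rewrite /chi; case: eqP => // _; apply: zeta_expr_eq.
by rewrite -modnMml E modnMml.
Qed.

Lemma chi_idx0 x : chi 0 x = (x != 0)%:R.
Proof. by rewrite /chi mul0n expr0; case: eqP. Qed.

Lemma chi_dvd i x : (e %| i)%N -> chi i x = (x != 0)%:R.
Proof. by move=> /eqP E; rewrite -chi_idx0; apply: chi_mod; rewrite mod0n. Qed.

Lemma chi_mulX i k x : (0 < k)%N -> chi (i * k) x = chi i (x ^+ k).
Proof.
move=> k0; have [->|x0] := eqVneq x 0.
  by rewrite expr0n -leqn0 leqNgt k0 /= !chi0.
have [j ->] := prim_exp_surj alpha_prim x0.
by rewrite -exprM !chi_exp mulnAC -mulnA.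
Qed.

Lemma chi_idxX i k x : (0 < k)%N -> chi (i * k) x = chi i x ^+ k.
Proof.
move=> k0; have [->|x0] := eqVneq x 0.
  by rewrite !chi0 expr0n -leqn0 leqNgt k0.
by rewrite /chi (negPf x0) mulnAC exprM.
Qed.

Lemma chi_class j x : x \in C -> chi j x = 1.
Proof.
case/classP => k ->; rewrite chi_exp mulnCA exprM.
by rewrite (prim_expr_order zeta_prim) expr1n.
Qed.

Lemma sum_chi j : ~~ (e %| j)%N -> \sum_x chi j x = 0.
Proof.
move=> ej; apply: (@sum_mul_morph0 _ _ _ a); [exact: chiM|exact: prim_neq0|].
rewrite -(expr1 a) chi_exp muln1 -(expr0 zeta).
by rewrite (eq_prim_root_expr zeta_prim) mod0n.
Qed.

Lemma sum_chi_idx x : \sum_(j < e) chi j x = (e * (x \in C))%:R.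
Proof.
have [->|x0] := eqVneq x 0.
  rewrite big1 => [|j _]; last exact: chi0.
  case E: (0 \in C); last by rewrite muln0.
  by have := class_neq0 E; rewrite eqxx.
have [xC|xC] := boolP (x \in C).
  rewrite (eq_bigr (fun _ => 1)) => [|j _]; last by rewrite chi_class.
  by rewrite sumr_const card_ord muln1.
rewrite muln0; move: xC; rewrite (class_dlog alpha_prim cardF) x0 /= => nd.
pose w := zeta ^+ dlog alpha x.
have w1 : w != 1.
  by rewrite /w -(expr0 zeta) (eq_prim_root_expr zeta_prim) mod0n.
apply/eqP; rewrite -(inj_eq (mulfI (_ : w - 1 != 0))) ?subr_eq0 // mulr0.
rewrite (eq_bigr (fun j : 'I_e => w ^+ j)) => [|j _]; last first.
  by rewrite /chi (negPf x0) mulnC exprM.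
by rewrite -subrX1 /w -exprM mulnC exprM (prim_expr_order zeta_prim) expr1n subrr.
Qed.

Definition jacobi i j : R := \sum_x chi i x * chi j (1 - x).

Lemma jacobi_mod i i' j j' : i = i' %[mod e] -> j = j' %[mod e] ->
  jacobi i j = jacobi i' j'.
Proof.
by move=> Ei Ej; apply: eq_bigr => x _; rewrite (chi_mod _ Ei) (chi_mod _ Ej).
Qed.

Lemma jacobiC i j : jacobi i j = jacobi j i.
Proof.
rewrite /jacobi (reindex_inj (inj_comp (addrI 1) oppr_inj)) /=.
by apply: eq_bigr => x _; rewrite subKr mulrC.
Qed.

(** The full sum of chi_j is 0, and the convention [chi 0 0 = 0] removes from it the term
    [chi j 1 = 1]. *)
Lemma jacobi0 j : ~~ (e %| j)%N -> jacobi 0 j = -1.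
Proof.
move=> ej; rewrite /jacobi (bigD1 0) //= chi0 mul0r add0r.
have /eqP := sum_chi ej.
rewrite (reindex_inj (inj_comp (addrI 1) oppr_inj)) /= (bigD1 0) //=.
rewrite subr0 chi1 addrC addr_eq0 => /eqP <-.
by apply: eq_bigr => x x0; rewrite chi_idx0 x0 mul1r.
Qed.

(* Substitute [x / (x - 1)] for [x]. *)
Lemma jacobi_refl i j k : (e %| i + j + k)%N ->
  jacobi i j = chi i (-1) * jacobi i k.
Proof.
move=> ijk; rewrite /jacobi (bigD1 1) //= subrr chi0 mulr0 add0r.
rewrite mulr_sumr [RHS](bigD1 1) //= subrr chi0 !mulr0 add0r.
pose h (x : F) := x / (x - 1).
have hh x : x != 1 -> h (h x) = x.
  rewrite -subr_eq0 => x1; rewrite /h.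
  have -> : x / (x - 1) - 1 = (x - 1)^-1 by field.
  by rewrite invrK mulfVK.
rewrite (reindex_onto h h) //=; apply: eq_big => x.
  have [->|x1] := eqVneq x 1; last first.
    rewrite hh // eqxx andbT; apply/negP => /eqP hx.
    have := hh _ x1; rewrite hx /h subrr invr0 mulr0 => x0.
    by move/esym/eqP: hx; rewrite -x0 /h mul0r oner_eq0.
  by rewrite /h subrr invr0 mulr0 mul0r [0 == 1]eq_sym oner_eq0 andbF.
case/andP => _; have [->|x1 _] := eqVneq x 1.
  by rewrite /h subrr invr0 mulr0 mul0r eq_sym oner_eq0.
have x1' : 1 - x != 0 by rewrite subr_eq0 eq_sym.
have x1'' : x - 1 != 0 by rewrite subr_eq0.
have -> : 1 - h x = (1 - x)^-1 by rewrite /h; field; rewrite x1' x1''.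
have -> : h x = -1 * (x * (1 - x)^-1) by rewrite /h; field; rewrite x1' x1''.
rewrite !chiM !chiV -!mulrA; congr (_ * (_ * _)).
have := chi_dvd (1 - x) ijk; rewrite x1' !chiD => E.
rewrite -invfM; apply: (mulfI (mulf_neq0 (chi_neq0 i x1') (chi_neq0 j x1'))).
by rewrite divff ?mulf_neq0 ?chi_neq0 // E.
Qed.

Lemma chiN1_sq i : chi i (-1) * chi i (-1) = 1.
Proof. by rewrite -chiM mulrNN mulr1 chi1. Qed.

Lemma jacobi_inv i j : (e %| i + j)%N -> ~~ (e %| i)%N ->
  jacobi i j = - chi i (-1).
Proof.
move=> ij ni; rewrite (@jacobi_refl i j 0) ?addn0 //.
by rewrite jacobiC jacobi0 // mulrN1.
Qed.

Lemma conv_chi i j x : ~~ (e %| i + j)%N ->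
  conv (chi i) (chi j) x = jacobi i j * chi (i + j) x.
Proof.
move=> ij; rewrite /conv; have [->|x0] := eqVneq x 0.
  rewrite chi0 mulr0 (eq_bigr (fun y => chi (i + j) y * chi j (-1))).
    by rewrite -mulr_suml sum_chi // mul0r.
  by move=> y _; rewrite sub0r -(mulN1r y) chiM chiD; ring.
rewrite (reindex_inj (mulfI x0)) /= mulr_suml; apply: eq_bigr => y _.
rewrite -{2}(mulr1 x) -mulrBr !chiM chiD; ring.
Qed.

Lemma jacobi_assoc i j k : ~~ (e %| i + j)%N -> ~~ (e %| j + k)%N ->
  jacobi i j * jacobi (i + j) k = jacobi j k * jacobi i (j + k).
Proof.
move=> ij jk; have := convA (chi i) (chi j) (chi k) 1.
rewrite {1}/conv (eq_bigr (fun y => jacobi i j * (chi (i + j) y * chi k (1 - y)))).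
  rewrite -mulr_sumr => ->; rewrite /conv mulr_sumr; apply: eq_bigr => y _.
  by rewrite -/(conv _ _ _) conv_chi // mulrCA.
by move=> y _; rewrite conv_chi // mulrA.
Qed.

(** Degenerate counterpart of [conv_chi]: the product character is trivial, and the convolution is a
    constant plus a multiple of the delta function at 0. *)
Lemma conv_chi_inv j k x : ~~ (e %| j)%N -> (e %| j + k)%N ->
  conv (chi j) (chi k) x = chi j (-1) * (#|F|%:R * (x == 0)%:R - 1).
Proof.
move=> nj jk; rewrite /conv.
have kN : chi k (-1) = chi j (-1).
  have := chi_dvd (-1) jk; rewrite oppr_eq0 oner_eq0 /= chiD => E.
  by rewrite -[LHS]mul1r -(chiN1_sq j) -mulrA E mulr1.
have [->|x0] := eqVneq x 0.
  rewrite (eq_bigr (fun y => (y != 0)%:R * chi j (-1))).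
    rewrite -mulr_suml mulrC; congr (_ * _); rewrite mulr1 -natr_sum.
    rewrite -big_mkcond sum1_card (cardC1 (0 : F)) -subn1 natrB //.
    exact: ltnW (finNzRing_gt1 F).
  by move=> y _; rewrite sub0r -(mulN1r y) chiM kN -(chi_dvd y jk) chiD; ring.
rewrite mulr0 sub0r mulrN1 -(jacobi_inv jk nj) /jacobi.
rewrite (reindex_inj (mulfI x0)) /=; apply: eq_bigr => y _.
rewrite -{2}(mulr1 x) -mulrBr !chiM mulrACA -chiD chi_dvd // x0 mul1r //.
Qed.

(** The Jacobi sum with opposite indices stands for the complex conjugate, which keeps the argument
    valid in any [numFieldType]. Associate chi_i, chi_j, chi_j' in two ways: the product of the last
    two is trivial, and its delta function contributes [#|F|]. *)
Lemma jacobi_norm i j i' j' :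
    ~~ (e %| i)%N -> ~~ (e %| j)%N -> ~~ (e %| i + j)%N ->
    (e %| i + i')%N -> (e %| j + j')%N ->
  jacobi i j * jacobi i' j' = #|F|%:R.
Proof.
move=> ni nj nij ii jj.
have := convA (chi i) (chi j) (chi j') 1.
rewrite {1}/conv (eq_bigr (fun y => jacobi i j * (chi (i + j) y * chi j' (1 - y))));
  last first.
  by move=> y _; rewrite conv_chi // mulrA.
rewrite -mulr_sumr -/(jacobi (i + j) j').
have -> : jacobi (i + j) j' = chi j (-1) * jacobi i' j'.
  rewrite jacobiC (@jacobi_refl j' (i + j) i'); last first.
    by have := dvdn_add ii jj; congr (_ %| _)%N; ring.
  rewrite (jacobiC j'); congr (_ * _).
  have := chi_dvd (-1) jj; rewrite oppr_eq0 oner_eq0 /= chiD => E.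
  by rewrite -[LHS]mul1r -(chiN1_sq j) -mulrA E mulr1.
rewrite /conv (eq_bigr (fun y => chi j (-1) * (#|F|%:R * (chi i y * (1 - y == 0)%:R)
  - chi i y))); last first.
  by move=> y _; rewrite -/(conv _ _ _) conv_chi_inv //; ring.
rewrite -mulr_sumr sumrB sum_chi // subr0 -mulr_sumr (bigD1 1) //= subrr eqxx.
rewrite big1 => [|y y1]; last by rewrite subr_eq0 eq_sym (negPf y1) mulr0.
rewrite chi1 addr0 mulr1 mulr1 mulrCA.
by apply: mulfI; apply: chi_neq0; rewrite oppr_eq0 oner_eq0.
Qed.

Lemma jacobi_neq0 i j :
    ~~ (e %| i)%N -> ~~ (e %| j)%N -> ~~ (e %| i + j)%N -> jacobi i j != 0.
Proof.
move=> ni nj nij; apply/eqP => J0.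
have H k : (e %| k + k * e.-1)%N.
  by rewrite -mulnS prednK ?dvdn_mull // (e_gt0 alpha_prim cardF).
have := jacobi_norm ni nj nij (H i) (H j); rewrite J0 mul0r => /eqP.
by rewrite eq_sym pnatr_eq0 -leqn0 leqNgt (ltnW (finNzRing_gt1 F)).
Qed.

(** * Relations involving the quadratic character *)

Section Even.

Variable h : nat.
Hypothesis e2h : e = (2 * h)%N.
Hypothesis F2 : 2 != 0 :> F.

Lemma h_gt0 : (0 < h)%N.
Proof. by have := e_gt0 alpha_prim cardF; rewrite e2h muln_gt0. Qed.

Lemma zeta_half : zeta ^+ h = -1.
Proof.
have /eqP := prim_expr_order zeta_prim; rewrite e2h mulnC exprM.
rewrite sqrf_eq1 => /orP[|/eqP //].
rewrite -(expr0 zeta) (eq_prim_root_expr zeta_prim) mod0n modn_small ?e2h.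
  by rewrite -leqn0 leqNgt h_gt0.
by rewrite mul2n -addnn -[X in (X < _)%N]addn0 ltn_add2l h_gt0.
Qed.

Lemma card_sqrt (u : F) : #|[pred v : F | v ^+ 2 == u]|%:R = 1 + chi h u :> R.
Proof.
have [->|u0] := eqVneq u 0.
  rewrite chi0 addr0; rewrite (@eq_card1 _ (0 : F)) // => v.
  by rewrite !inE expf_eq0.
have [i ui] := prim_exp_surj alpha_prim u0.
rewrite {2}ui chi_exp exprM zeta_half -signr_odd.
case oi: (odd i).
  rewrite expr1 subrr eq_card0 // => v; rewrite !inE; apply/negP => /eqP vu.
  have v0 : v != 0 by apply: contraNneq u0 => v0; rewrite -vu v0 expr0n.
  have [k vk] := prim_exp_surj alpha_prim v0.
  have /eqP : a ^+ (k * 2) = a ^+ i by rewrite exprM -vk vu.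
  rewrite (prim_expr_eq alpha_prim) => /eqP /(congr1 odd).
  by rewrite !odd_mod ?oi ?cardF ?e2h ?oddM ?andbF.
rewrite expr0.
have wu : (a ^+ i./2) ^+ 2 = u.
  by rewrite -exprM ui; congr (_ ^+ _); have := odd_double_half i; rewrite oi; lia.
set w := a ^+ i./2 in wu.
have w0 : w != 0 by rewrite expf_neq0 // prim_neq0.
have ww : w != - w by rewrite -addr_eq0 -mulr2n -mulr_natl mulf_neq0.
have -> : #|[pred v | v ^+ 2 == u]| = #|[set w; - w]|.
  by apply: eq_card => v; rewrite !inE -wu eqf_sqr.
by rewrite cards2 ww.
Qed.

Lemma sum_sqr (g : F -> R) : \sum_v g (v ^+ 2) = \sum_u g u * (1 + chi h u).
Proof.
rewrite (partition_big (fun v : F => v ^+ 2) predT) //=; apply: eq_bigr => u _.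
rewrite (eq_bigr (fun _ => g u)) => [|v /eqP -> //].
by rewrite sumr_const -card_sqrt mulr_natr.
Qed.

(** For [x = (1 + v) / 2] one has [4 x (1 - x) = 1 - v ^+ 2]; counting the square roots of [u] by
    [1 + chi h u] turns the sum over [v] into a sum over [u]. *)
Lemma jacobi_diag i : ~~ (e %| i)%N -> chi i 4 * jacobi i i = jacobi i h.
Proof.
move=> ni; rewrite [RHS]jacobiC /jacobi.
have E : \sum_v chi i (1 - v ^+ 2) = \sum_u chi h u * chi i (1 - u).
  rewrite (sum_sqr (fun u => chi i (1 - u))).
  under eq_bigr do rewrite mulrDr mulr1.
  rewrite big_split /= -[RHS]add0r; congr (_ + _); last first.
    by apply: eq_bigr => u _; rewrite mulrC.
  rewrite -[RHS](sum_chi ni) [RHS](reindex_inj (inj_comp (addrI 1) oppr_inj)) //.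
rewrite -E mulr_sumr.
rewrite (reindex_inj (inj_comp (mulIf (invr_neq0 F2)) (addrI 1))) /=.
apply: eq_bigr => v _; rewrite -!chiM; congr (chi _ _); by field.
Qed.

(** The Hasse-Davenport product relation for the quadratic character, obtained from associativity
    for [i, i, h] and [jacobi_diag] by cancelling [jacobi i i]. *)
Lemma jacobi_double i : ~~ (e %| i * 2)%N -> ~~ (e %| i + h)%N ->
  chi i 4 * jacobi i (i + h) = jacobi (i * 2) h.
Proof.
move=> ni2 nih.
have ni : ~~ (e %| i)%N by apply: contra ni2 => H; rewrite dvdn_mulr.
have nii : ~~ (e %| i + i)%N by rewrite addnn -muln2.
have nh : ~~ (e %| h)%N by rewrite e2h gtnNdvd ?h_gt0 // mul2n -addnn -[X in (X <
  _)%N]addn0 ltn_add2l h_gt0.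
apply: (mulfI (jacobi_neq0 ni ni nii)).
rewrite muln2 -addnn jacobi_assoc // -jacobi_diag //; ring.
Qed.

End Even.

(** * From Jacobi sums to difference multiplicities *)

Definition class_char_sum j : R := \sum_(z in C) chi j (1 - z).

Lemma class_char_sumE j : e%:R * class_char_sum j = \sum_(k < e) jacobi k j.
Proof.
rewrite /jacobi exchange_big /= /class_char_sum mulr_sumr big_mkcond /=.
apply: eq_bigr => x _; rewrite -mulr_suml sum_chi_idx.
by case: (x \in C); rewrite ?muln1 ?muln0 ?mul0r.
Qed.

Lemma class_char_sum0 : class_char_sum 0 = f%:R - 1.
Proof.
rewrite /class_char_sum (bigD1 1) ?class1 //= subrr chi0 add0r.
rewrite (eq_bigr (fun _ => 1)) => [|z /andP[_ z1]]; last first.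
  by rewrite chi_idx0 subr_eq0 eq_sym z1.
rewrite sumr_const; have := card_class alpha_prim cardF.
rewrite (cardD1 1) class1 => <-; rewrite natrD addrC addKr.
by congr (_%:R); apply: eq_card => z; rewrite !inE andbC.
Qed.

(** Fourier inversion. Writing [y = x z], the pairs of difference [g] solve [x (1 - z) = g]; for a
    given [z] there is one exactly when [g / (1 - z)] lies in [C], which the sum of all chi_j
    detects. *)
Lemma diff_multE (g : F) : g != 0 ->
  e%:R * (diff_mult C g)%:R = \sum_(j < e) chi j g^-1 * class_char_sum j.
Proof.
move=> g0; have := @sum_class_diff F alpha e R (fun d => (d == g)%:R).
rewrite eq_sym (negPf g0) => /(_ erefl).
rewrite [X in _ = X -> _](bigD1 g) //= eqxx mulr1.
rewrite [X in _ = _ + X -> _]big1 ?addr0 => [<-|d dg]; last first.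
  by rewrite (negPf dg) mulr0.
rewrite (eq_bigr (fun x => \sum_(z in C) (x * (1 - z) == g)%:R)); last first.
  move=> x xC; rewrite -(sum_class_mul alpha_prim cardF _ xC).
  by apply: eq_bigr => z _; rewrite mulrBr mulr1.
rewrite exchange_big /= mulr_sumr.
rewrite /class_char_sum; under [RHS]eq_bigr do rewrite mulr_sumr.
rewrite [RHS]exchange_big /=; apply: eq_bigr => z zC.
under [RHS]eq_bigr do rewrite -chiM.
rewrite sum_chi_idx natrM; congr (_ * _).
have [->|z1] := eqVneq z 1.
  rewrite subrr mulr0; case E: (0 \in C).
    by have := class_neq0 E; rewrite eqxx.
  by rewrite big1 // => x _; rewrite mulr0 eq_sym (negPf g0).
have z1' : 1 - z != 0 by rewrite subr_eq0 eq_sym.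
have -> : (g^-1 * (1 - z) \in C) = (g / (1 - z) \in C).
  by apply/idP/idP => /(classV alpha_prim cardF); rewrite invfM invrK mulrC.
rewrite (eq_bigr (fun x => (x == g / (1 - z))%:R)); last first.
  by move=> x _; rewrite -(inj_eq (mulIf (invr_neq0 z1'))) mulfK.
have [xC|xC] := boolP (_ \in C).
  by rewrite (bigD1 (g / (1 - z))) //= eqxx big1 ?addr0 // => x /andP[_ /negPf ->].
by rewrite big1 // => x xC'; case: eqP => // E; rewrite -E xC' in xC.
Qed.

Lemma diff_mult_const A : (forall j, (0 < j < e)%N -> class_char_sum j = A) ->
  forall g : F, g != 0 ->
  e%:R * (diff_mult C g)%:R = f%:R - 1 - A + (if g \in C then e%:R * A else 0).
Proof.
move=> HA g g0; rewrite diff_multE //.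
have := sum_chi_idx g^-1.
have e0 := e_gt0 alpha_prim cardF.
have gC : (g^-1 \in C) = (g \in C).
  by apply/idP/idP => /(classV alpha_prim cardF); rewrite ?invrK.
rewrite gC -!(big_mkord xpredT (fun j => chi j g^-1)).
rewrite -!(big_mkord xpredT (fun j => chi j g^-1 * class_char_sum j)).
rewrite !(big_ltn e0) class_char_sum0 chi_idx0 invr_eq0 g0 mul1r => E.
rewrite (eq_big_nat _ _ (F2 := fun j => chi j g^-1 * A)); last first.
  by move=> j Hj; rewrite HA.
rewrite -mulr_suml; move: E; set s := \sum_(1 <= _ < _) _ => E.
have -> : s = (e * (g \in C))%:R - 1 by rewrite -E addrC addKr.
by case: (g \in C); rewrite ?muln1 ?muln0; ring.
Qed.

Lemma pds_class_char_sum v k l mu j : pds C v k l mu -> ~~ (e %| j)%N ->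
  class_char_sum j = l%:R - mu%:R.
Proof.
move=> P ej; apply: (pds_char_sum alpha_prim cardF P).
- exact: chi0.
- exact: chiM.
- by move=> x; apply: chi_class.
- exact: sum_chi.
- by rewrite pnatr_eq0 -leqn0 leqNgt (f_gt0 alpha_prim cardF).
Qed.

End Characters.

(** * The semiprimitive case *)

Section Semiprimitive.

Variables (F : finFieldType) (alpha : {unit F}).
Hypothesis alpha_prim : primitive_element alpha.
Variables (e f : nat).
Hypothesis cardF : #|F|.-1 = (e * f)%N.
Variables (R : numFieldType) (zeta : R).
Hypothesis zeta_prim : e.-primitive_root zeta.
Variables (p m : nat).
Hypotheses (p_prime : prime p) (cardFp : #|F| = (p ^ m)%N).
Hypotheses (ep : (e %| p.+1)%N) (m_even : ~~ odd m).

Local Notation a := (FinRing.uval alpha).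
Local Notation C := (cyclotomic_class0 alpha e).
Local Notation chi := (chi alpha zeta).
Local Notation jacobi := (jacobi alpha zeta).

Lemma pcharF : p \in [pchar F].
Proof. exact: card_finPcharP cardFp p_prime. Qed.

(* The prime field has index divisible by [p + 1], hence by [e]. *)
Lemma natr_in_class n : n%:R != 0 :> F -> n%:R \in C.
Proof.
move=> n0; rewrite (class_dlog alpha_prim cardF) n0 /=.
have p1 := prime_gt1 p_prime.
have E : (n%:R : F) ^+ p.-1 = 1.
  apply: (mulfI n0); rewrite mulr1 -exprS prednK ?prime_gt0 //.
  by rewrite -(pFrobenius_autE pcharF) pFrobenius_aut_nat.
have /eqP : a ^+ (dlog alpha n%:R * p.-1) = a ^+ 0.
  by rewrite exprM dlogK.
rewrite (prim_expr_eq alpha_prim) mod0n cardFp.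
have [r Er] : exists r, (p ^ m).-1 = (p.-1 * (p.+1 * r))%N.
  have -> : (p ^ m = (p ^ 2) ^ m./2)%N.
    by rewrite -expnM mul2n even_halfK.
  exists (\sum_(i < m./2) (p ^ 2) ^ i)%N.
  rewrite predn_exp mulnA; congr (_ * _)%N.
  by move: p1; rewrite -mulnn; case: (p) => // n' _; nia.
rewrite Er -/(dvdn _ _) (mulnC (dlog alpha _)) dvdn_pmul2l; last by lia.
by move=> H; apply: dvdn_trans ep (dvdn_trans (dvdn_mulr _ (dvdnn _)) H).
Qed.

Lemma chiN1 i : chi i (-1) = 1.
Proof.
have -> : -1 = p.-1%:R :> F.
  by rewrite -subn1 natrB ?prime_gt0 // (pcharf0 pcharF) sub0r.
apply: (chi_class alpha_prim cardF zeta_prim); apply: natr_in_class.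
by rewrite -subn1 natrB ?prime_gt0 // (pcharf0 pcharF) sub0r oppr_eq0 oner_eq0.
Qed.

Lemma jacobi_frob i j : jacobi (i * p) (j * p) = jacobi i j.
Proof.
have p0 := prime_gt0 p_prime.
rewrite [RHS](reindex_inj (fmorph_inj (pFrobenius_aut pcharF))) /=.
apply: eq_bigr => x _; rewrite !(chi_mulX alpha_prim cardF zeta_prim) //.
by rewrite -!(pFrobenius_autE pcharF) rmorphB rmorph1.
Qed.

Lemma jacobi_neg i j i' j' : (e %| i + i')%N -> (e %| j + j')%N ->
  jacobi i j = jacobi i' j'.
Proof.
have H k k' : (e %| k + k')%N -> k * p = k' %[mod e].
  move=> kk; apply/eqP; rewrite -(eqn_modDr k) -mulnSr (addnC k').
  by move: kk; rewrite /dvdn => /eqP ->; rewrite (eqP (dvdn_mull k ep)).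
by move=> /H Ei /H Ej; rewrite -jacobi_frob; apply: (jacobi_mod alpha zeta_prim).
Qed.

Lemma jacobi_refl1 i j k : (e %| i + j + k)%N -> jacobi i j = jacobi i k.
Proof.
move=> E.
by rewrite (jacobi_refl alpha_prim cardF zeta_prim E) chiN1 mul1r.
Qed.

Lemma jacobi_inv1 i j : (e %| i + j)%N -> ~~ (e %| i)%N -> jacobi i j = -1.
Proof.
by move=> ij ni; rewrite (jacobi_inv alpha_prim cardF zeta_prim ij ni) chiN1.
Qed.

Lemma jacobi_pm i j : ~~ (e %| i)%N -> ~~ (e %| j)%N -> ~~ (e %| i + j)%N ->
  exists2 s : int, jacobi i j = s%:~R & s = (p ^ m./2)%N%:Z \/ s = - (p ^ m./2)%N%:Z.
Proof.
move=> ni nj nij.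
have H k : (e %| k + k * p)%N by rewrite -mulnS dvdn_mull.
have := jacobi_norm alpha_prim cardF zeta_prim ni nj nij (H i) (H j).
rewrite jacobi_frob -expr2 cardFp.
have -> : (p ^ m = (p ^ m./2) ^ 2)%N.
  by rewrite -expnM muln2 even_halfK.
move/eqP; rewrite natrX eqf_sqr => /orP[]/eqP ->.
  by exists (p ^ m./2)%N%:Z; [rewrite pmulrn|left].
by exists (- (p ^ m./2)%N%:Z); [rewrite rmorphN /= pmulrn|right].
Qed.

Lemma chi4 i : 2 != 0 :> F -> chi i 4 = 1.
Proof.
move=> F2; apply: (chi_class alpha_prim cardF zeta_prim); apply: natr_in_class.
by rewrite (natrM _ 2 2) mulf_neq0.
Qed.

End Semiprimitive.

(** * The parameters determined by the class *)

Section PdsUnique.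

Variables (F : finFieldType) (alpha : {unit F}).
Hypothesis alpha_prim : primitive_element alpha.
Variables (e f : nat).
Hypothesis cardF : #|F|.-1 = (e * f)%N.
Hypothesis e1 : (1 < e)%N.

Local Notation a := (FinRing.uval alpha).
Local Notation C := (cyclotomic_class0 alpha e).

Lemma pds_unique v k l mu : pds C v k l mu ->
  [/\ v = #|F|, k = f, l = diff_mult C 1 & mu = diff_mult C a].
Proof.
case=> -> <- H; split=> //; first exact: card_class.
  by rewrite H class1 andbF muln1 muln0 addn0.
have /negPf aC := prim_notin_class alpha_prim cardF e1.
by rewrite H prim_neq0 aC muln0 muln1.
Qed.

Lemma diff_mult0 (G : finZmodType) (P : {set G}) : diff_mult P 0 = 0%N.
Proof.
rewrite /diff_mult; apply/eqP; rewrite cards_eq0; apply/eqP/setP => xy.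
by rewrite !inE subr_eq0; case: eqP; rewrite ?andbF.
Qed.

(** Converse of [pds_class_char_sum]. The parameters are read at [1], inside [C], and at [alpha],
    outside it; [A] carries a factor [e], being a sum of Jacobi sums, hence the scaling by
    [e * e]. *)
Lemma pds_const (R : numFieldType) (zeta : R) (A : R) :
    e.-primitive_root zeta ->
    (forall j, (0 < j < e)%N -> e%:R * class_char_sum alpha e zeta j = A) ->
  [/\ pds C #|F| f (diff_mult C 1) (diff_mult C a),
      (e * e * diff_mult C 1)%:R = #|F|%:R - 1 - e%:R - A + e%:R * A
    & (e * e * diff_mult C a)%:R = #|F|%:R - 1 - e%:R - A].
Proof.
move=> zeta_prim HA.
have e0 : e%:R != 0 :> R by rewrite pnatr_eq0 -lt0n ltnW.
have HA' j : (0 < j < e)%N -> class_char_sum alpha e zeta j = A / e%:R.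
  by move=> /HA <-; rewrite mulrC mulKf.
have D := diff_mult_const alpha_prim cardF zeta_prim HA'.
have q1 : #|F|%:R = 1 + e%:R * f%:R :> R.
  by rewrite -natrM -cardF nat1r (prednK (ltnW (finNzRing_gt1 F))).
have aC := prim_notin_class alpha_prim cardF e1.
split.
- split=> //; first exact: card_class.
  move=> g; have [->|g0] := eqVneq g 0.
    rewrite diff_mult0 andFb muln0 addn0; case E: (0 \in C); last by rewrite muln0.
    by have := class_neq0 E; rewrite eqxx.
  have [gC|gC] := boolP (g \in C); rewrite /= ?muln1 ?muln0 ?addn0 ?add0n.
    apply/eqP; rewrite -(eqr_nat R) -(inj_eq (mulfI e0)) !D ?oner_eq0 //.
    by rewrite gC class1.
  apply/eqP; rewrite -(eqr_nat R) -(inj_eq (mulfI e0)) !D ?oner_eq0 ?prim_neq0 //.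
  by rewrite (negPf gC) (negPf aC).
- rewrite !natrM -mulrA D ?oner_eq0 // class1 q1; by field.
- rewrite !natrM -mulrA D ?prim_neq0 // (negPf aC) q1; by field.
Qed.

Lemma diff_multN (G : finZmodType) (P : {set G}) g :
  diff_mult P (- g) = diff_mult P g.
Proof.
pose sw (xy : G * G) := (xy.2, xy.1).
have swK : involutive sw by case.
rewrite /diff_mult -(card_imset _ (inv_inj swK)); apply: eq_card => xy.
rewrite -[xy in LHS]swK (mem_imset _ _ (inv_inj swK)) !inE /= eq_sym.
by rewrite -opprB eqr_opp [(xy.2 \in P) && _]andbC.
Qed.

(** Elements of [C] satisfy [x ^+ f = 1], so [-1] is outside [C] for odd [f]. Differences come in
    opposite pairs, hence the multiplicities at 1 and -1 agree. *)
Lemma pds_odd h v k l mu : e = (2 * h)%N -> 2 != 0 :> F -> odd f ->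
  pds C v k l mu -> l = mu.
Proof.
move=> eh F2 of_ [_ _ H].
have N1 : -1 \notin C.
  apply/negP => /(class_expr alpha_prim cardF); rewrite -signr_odd of_ expr1.
  move/eqP; rewrite eq_sym -subr_eq0 opprK => E; by rewrite -(natrD _ 1 1) (negPf F2)
    in E.
have := diff_multN C 1; rewrite !H class1 (negPf N1) /= oppr_eq0 oner_eq0.
by rewrite !muln0 !muln1 addn0 add0n.
Qed.

End PdsUnique.

Lemma ord_pos_cases (P : nat -> Prop) n :
  (forall j : 'I_n, (0 < j)%N -> P j) -> forall j, (0 < j < n)%N -> P j.
Proof. by move=> H j /andP[j0 jn]; apply: (H (Ordinal jn)). Qed.

(** * The character sums for each e when p = -1 mod e *)

Section SemiprimitiveSums.

Variables (F : finFieldType) (alpha : {unit F}).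
Hypothesis alpha_prim : primitive_element alpha.
Variables (p m : nat).
Hypotheses (p_prime : prime p) (cardFp : #|F| = (p ^ m)%N).
Hypothesis m_even : ~~ odd m.

Local Notation a := (FinRing.uval alpha).
Local Notation N := (p ^ m./2)%N.

(** In S_j the terms [J(0, j)] and [J(-j, j)] are -1 and the other [e - 2] equal [s], whence the
    shape of [S]. The equations are brought down to integers so that divisibility by [e * e] can
    decide the sign of [s]. *)
Lemma semiprimitive_pds e f (zeta : algC) (s : int) :
    #|F|.-1 = (e * f)%N -> (1 < e)%N -> e.-primitive_root zeta ->
    (forall j, (0 < j < e)%N ->
       e%:R * class_char_sum alpha e zeta j = -2 + (e%:R - 2) * s%:~R) ->
  let C := cyclotomic_class0 alpha e in
  let S := -2 + (e%:Z - 2) * s in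
  [/\ pds C (p ^ m)%N f (diff_mult C 1) (diff_mult C a),
      (e * e * diff_mult C 1%R)%N%:Z = (p ^ m)%N%:Z - 1 - e%:Z - S + e%:Z * S
    & (e * e * diff_mult C a)%N%:Z = (p ^ m)%N%:Z - 1 - e%:Z - S].
Proof.
move=> cardF e1 zp HA C S.
have [P E1 Ea] := pds_const alpha_prim cardF e1 zp HA.
split; first by rewrite -cardFp.
- by apply: (@intr_inj algC); rewrite -pmulrn E1 -cardFp /S; ring.
- by apply: (@intr_inj algC); rewrite -pmulrn Ea -cardFp /S; ring.
Qed.

Lemma semiprimitive3 f : #|F|.-1 = (3 * f)%N -> (p %% 3 = 2)%N ->
  exists s (zeta : algC), [/\ s = N%:Z \/ s = - N%:Z, 3.-primitive_root zeta
    & forall j, (0 < j < 3)%N ->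
       3 * class_char_sum alpha 3 zeta j = -2 + s%:~R].
Proof.
move=> cardF p2; have [zeta zp] := C_prim_root_exists (isT : 0 < 3)%N.
have ep : (3 %| p.+1)%N by lia.
have J0 := jacobi0 alpha_prim cardF zp.
have Ji := jacobi_inv1 alpha_prim cardF zp p_prime cardFp ep m_even.
have Jn := jacobi_neg alpha_prim cardF zp p_prime cardFp ep.
have [s Es ss] := jacobi_pm alpha_prim cardF zp p_prime cardFp ep m_even
  (isT : ~~ (3 %| 1)%N) (isT : ~~ (3 %| 1)%N) isT.
exists s, zeta; split=> //; apply: ord_pos_cases.
case=> [[|[|[|//]]] lt] // _ /=; rewrite (class_char_sumE alpha_prim cardF zp)
  !big_ord_recr big_ord0 /=.
  by rewrite J0 // (Ji 2 1)%N // Es; ring.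
by rewrite J0 // (Ji 1 2)%N // (Jn 2 2 1 1)%N // Es; ring.
Qed.

Lemma semiprimitive4 f : #|F|.-1 = (4 * f)%N -> (p %% 4 = 3)%N ->
  exists s (zeta : algC), [/\ s = N%:Z \/ s = - N%:Z, 4.-primitive_root zeta
    & forall j, (0 < j < 4)%N ->
       4 * class_char_sum alpha 4 zeta j = -2 + (4 - 2) * s%:~R].
Proof.
move=> cardF p2; have [zeta zp] := C_prim_root_exists (isT : 0 < 4)%N.
have ep : (4 %| p.+1)%N by lia.
have J0 := jacobi0 alpha_prim cardF zp.
have Ji := jacobi_inv1 alpha_prim cardF zp p_prime cardFp ep m_even.
have Jn := jacobi_neg alpha_prim cardF zp p_prime cardFp ep.
have Jr := jacobi_refl1 alpha_prim cardF zp p_prime cardFp ep m_even.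
have [s Es ss] := jacobi_pm alpha_prim cardF zp p_prime cardFp ep m_even
  (isT : ~~ (4 %| 1)%N) (isT : ~~ (4 %| 2)%N) isT.
have J11 := Jr 1 1 2 isT; have J21 := jacobiC alpha zeta 2 1.
have J32 := Jn 3 2 1 2 isT isT; have J23 := jacobiC alpha zeta 2 3.
have J33 := Jn 3 3 1 1 isT isT.
exists s, zeta; split=> //; apply: ord_pos_cases.
case=> [[|[|[|[|//]]]] lt] // _ /=; rewrite (class_char_sumE alpha_prim cardF zp)
  !big_ord_recr big_ord0 /=.
- by rewrite J0 // (Ji 3 1)%N // J21 J11 Es; ring.
- by rewrite J0 // (Ji 2 2)%N // J32 Es; ring.
- by rewrite J0 // (Ji 1 3)%N // J33 J23 J32 J11 Es; ring.
Qed.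

Lemma semiprimitive6 f : #|F|.-1 = (6 * f)%N -> (p %% 6 = 5)%N ->
  exists s (zeta : algC), [/\ s = N%:Z \/ s = - N%:Z, 6.-primitive_root zeta
    & forall j, (0 < j < 6)%N ->
       6 * class_char_sum alpha 6 zeta j = -2 + (6 - 2) * s%:~R].
Proof.
move=> cardF p2; have [zeta zp] := C_prim_root_exists (isT : 0 < 6)%N.
have ep : (6 %| p.+1)%N by lia.
have F2 : 2 != 0 :> F.
  by rewrite -(dvdn_pcharf (pcharF p_prime cardFp)) gtnNdvd //; lia.
have J0 := jacobi0 alpha_prim cardF zp.
have Ji := jacobi_inv1 alpha_prim cardF zp p_prime cardFp ep m_even.
have Jn := jacobi_neg alpha_prim cardF zp p_prime cardFp ep.
have Jr := jacobi_refl1 alpha_prim cardF zp p_prime cardFp ep m_even.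
have Jc := jacobiC alpha zeta.
have c4 i := chi4 alpha_prim cardF zp p_prime cardFp ep m_even i F2.
have Jd i := jacobi_diag alpha_prim cardF zp (erefl : 6 = 2 * 3)%N F2 (i := i).
(* Every nondegenerate sum is tied to [J(2, 3)]; as 4 lies in [C], the diagonal relation involves no
   character value. *)
have [s Es ss] := jacobi_pm alpha_prim cardF zp p_prime cardFp ep m_even
  (isT : ~~ (6 %| 2)%N) (isT : ~~ (6 %| 3)%N) isT.
have J32 : jacobi alpha zeta 3 2 = s%:~R by rewrite Jc.
have J13 : jacobi alpha zeta 1 3 = s%:~R by rewrite Jc (Jr 3 1 2)%N.
have J11 : jacobi alpha zeta 1 1 = s%:~R.
  by have := Jd 1%N isT; rewrite c4 mul1r => ->.
have J22 : jacobi alpha zeta 2 2 = s%:~R.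
  by have := Jd 2%N isT; rewrite c4 mul1r => ->.
have J21 : jacobi alpha zeta 2 1 = s%:~R by rewrite (Jr 2 1 3)%N.
have J12 : jacobi alpha zeta 1 2 = s%:~R by rewrite Jc.
have J31 : jacobi alpha zeta 3 1 = s%:~R by rewrite Jc.
have J14 : jacobi alpha zeta 1 4 = s%:~R by rewrite (Jr 1 4 1)%N.
have J41 : jacobi alpha zeta 4 1 = s%:~R by rewrite Jc.
have Jm i j : jacobi alpha zeta i j = s%:~R -> forall i' j', (6 %| i + i')%N -> (6 %|
  j + j')%N ->
   jacobi alpha zeta i' j' = s%:~R.
  by move=> <- i' j' Hi Hj; rewrite (Jn i j i' j').
exists s, zeta; split=> //; apply: ord_pos_cases.
case=> [[|[|[|[|[|[|//]]]]]] lt] // _ /=; rewrite (class_char_sumE alpha_prim cardF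
  zp) !big_ord_recr big_ord0 /=.
- by rewrite J0 // (Ji 5 1)%N // J11 J21 J31 J41; ring.
- by rewrite J0 // (Ji 4 2)%N // J12 J22 J32 (Jm 1 4)%N //; ring.
- by rewrite J0 // (Ji 3 3)%N // J13 Es (Jm 2 3)%N // (Jm 1 3)%N //; ring.
- by rewrite J0 // (Ji 2 4)%N // J14 (Jm 3 2)%N // (Jm 2 2)%N // (Jm 1 2)%N //; ring.
- by rewrite J0 // (Ji 1 5)%N // (Jm 4 1)%N // (Jm 3 1)%N // (Jm 2 1)%N // (Jm 1 1)%N
    //; ring.
Qed.

(** The right-hand side is [32 (2 n + 1)], of odd 2-adic valuation 5. *)
Lemma sq_neq_32mod64 (z : int) (n : nat) : z ^+ 2 <> 64 * n%:Z + 32.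
Proof.
have half (y : int) : exists w, y = 2 * w \/ y = 2 * w + 1.
  by exists (y %/ 2)%Z; lia.
move=> E; have [w [H|H]] := half z; last by rewrite H in E; lia.
have [u [H'|H']] := half w; last by rewrite H H' in E; lia.
have [v [H''|H'']] := half u; by rewrite H H' H'' in E; lia.
Qed.

Lemma semiprimitive8 f : #|F|.-1 = (8 * f)%N -> (p %% 8 = 7)%N ->
  exists s (zeta : algC), [/\ s = N%:Z \/ s = - N%:Z, 8.-primitive_root zeta
    & forall j, (0 < j < 8)%N ->
       8 * class_char_sum alpha 8 zeta j = -2 + (8 - 2) * s%:~R].
Proof.
move=> cardF p2; have [zeta zp] := C_prim_root_exists (isT : 0 < 8)%N.
have ep : (8 %| p.+1)%N by lia.
have F2 : 2 != 0 :> F.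
  by rewrite -(dvdn_pcharf (pcharF p_prime cardFp)) gtnNdvd //; lia.
have J0 := jacobi0 alpha_prim cardF zp.
have Ji := jacobi_inv1 alpha_prim cardF zp p_prime cardFp ep m_even.
have Jn := jacobi_neg alpha_prim cardF zp p_prime cardFp ep.
have Jr := jacobi_refl1 alpha_prim cardF zp p_prime cardFp ep m_even.
have Jc := jacobiC alpha zeta.
have c4 i := chi4 alpha_prim cardF zp p_prime cardFp ep m_even i F2.
have Jd i := jacobi_diag alpha_prim cardF zp (erefl : 8 = 2 * 4)%N F2 (i := i).
(* The relations used below leave two families of Jacobi sums, represented by [J(2, 4)] and
   [J(1, 4)]. *)
have [s J24 ss] := jacobi_pm alpha_prim cardF zp p_prime cardFp ep m_even
  (isT : ~~ (8 %| 2)%N) (isT : ~~ (8 %| 4)%N) isT.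
have [t J14 tt'] := jacobi_pm alpha_prim cardF zp p_prime cardFp ep m_even
  (isT : ~~ (8 %| 1)%N) (isT : ~~ (8 %| 4)%N) isT.
have J15 : jacobi alpha zeta 1 5 = s%:~R.
  have := jacobi_double alpha_prim cardF zp (erefl : 8 = 2 * 4)%N F2
    (isT : ~~ (8 %| 1 * 2)%N) isT.
  by rewrite c4 mul1r => ->.
have J11 : jacobi alpha zeta 1 1 = t%:~R.
  by have := Jd 1%N isT; rewrite c4 mul1r => ->.
have J12 : jacobi alpha zeta 1 2 = s%:~R by rewrite (Jr 1 2 5)%N.
have J13 : jacobi alpha zeta 1 3 = t%:~R by rewrite (Jr 1 3 4)%N.
have J16 : jacobi alpha zeta 1 6 = t%:~R by rewrite (Jr 1 6 1)%N.
have J22 : jacobi alpha zeta 2 2 = s%:~R by rewrite (Jr 2 2 4)%N.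
have J21 : jacobi alpha zeta 2 1 = s%:~R by rewrite Jc.
have J25 : jacobi alpha zeta 2 5 = s%:~R by rewrite (Jr 2 5 1)%N.
have J41 : jacobi alpha zeta 4 1 = t%:~R by rewrite Jc.
have J43 : jacobi alpha zeta 4 3 = t%:~R by rewrite (Jr 4 3 1)%N.
have J34 : jacobi alpha zeta 3 4 = t%:~R by rewrite Jc.
have J33 : jacobi alpha zeta 3 3 = t%:~R.
  by have := Jd 3%N isT; rewrite c4 mul1r => ->.
have J32 : jacobi alpha zeta 3 2 = t%:~R by rewrite (Jr 3 2 3)%N.
have Jm i j : jacobi alpha zeta i j = s%:~R -> forall i' j', (8 %| i + i')%N -> (8 %|
  j + j')%N ->
   jacobi alpha zeta i' j' = s%:~R.
  by move=> <- i' j' Hi Hj; rewrite (Jn i j i' j').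
have Jm' i j : jacobi alpha zeta i j = t%:~R -> forall i' j', (8 %| i + i')%N -> (8
  %| j + j')%N ->
   jacobi alpha zeta i' j' = t%:~R.
  by move=> <- i' j' Hi Hj; rewrite (Jn i j i' j').
have S j : (0 < j < 8)%N -> 8 * class_char_sum alpha 8 zeta j =
    -2 + (if (j == 2) || (j == 6) then 2 * t%:~R + 4 * s%:~R else 4 * t%:~R + 2 * s%:~R).
  move: j; apply: ord_pos_cases.
  case=> [[|[|[|[|[|[|[|[|//]]]]]]]] lt] // _ /=; rewrite (class_char_sumE alpha_prim
    cardF zp) !big_ord_recr big_ord0 /=.
  - by rewrite J0 // (Ji 7 1)%N // J11 J21 J41 (Jc 3) (Jc 5) (Jc 6) J13 J15 J16; ring.
  - by rewrite J0 // (Ji 6 2)%N // J12 J22 J32 (Jc 4) J24 (Jc 5) J25 (Jm' 1 6)%N //; ring.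
  - rewrite J0 // (Ji 5 3)%N // J13 (Jc 2) J32 J33 J43 (Jm 2 5)%N // (Jm 1 5)%N //; ring.
  - rewrite J0 // (Ji 4 4)%N // J14 J24 J34 (Jm' 3 4)%N // (Jm 2 4)%N // (Jm' 1 4)%N
      //; ring.
  - rewrite J0 // (Ji 3 5)%N // J15 J25 (Jm' 4 3)%N // (Jm' 3 3)%N // (Jc 6) (Jm' 3
      2)%N // (Jm' 1 3)%N //; ring.
  - rewrite J0 // (Ji 2 6)%N // J16 (Jc 3) (Jc 4) (Jm 2 5)%N // (Jm 2 4)%N // (Jm' 3
      2)%N // (Jm 2 2)%N // (Jm 1 2)%N //; ring.
  - rewrite J0 // (Ji 1 7)%N // (Jc 2) (Jm' 1 6)%N // (Jc 3) (Jm 1 5)%N // (Jm' 4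
      1)%N // (Jc 5) (Jm' 1 3)%N // (Jm 2 1)%N // (Jm' 1 1)%N //; ring.
suff ts : t = s.
  by exists s, zeta; split=> // j /S ->; rewrite ts; case: ifP => _; ring.
have [//|ts] : t = s \/ t = - s by case: ss => ->; case: tt' => ->; rewrite ?opprK; tauto.
(* If [t = - s], two of the nontrivial sums S_j are [-2 + 2 s] and five are [-2 - 2 s], so that
   [64 D = q - 23 - 6 s = (s - 3) ^+ 2 - 32]. *)
exfalso; pose D := diff_mult (cyclotomic_class0 alpha 8) 1.
have q1 : (p ^ m)%:R = 1 + 8 * f%:R :> algC.
  by rewrite -cardFp -natrM -cardF nat1r (prednK (ltnW (finNzRing_gt1 F))).
have sq : (p ^ m)%N%:Z = s ^+ 2.
  rewrite -{1}(even_halfK m_even) -muln2 expnM PoszM.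
  by case: ss => ->; rewrite ?sqrrN.
suff E : s ^+ 2 - 6 * s - 23 = 64 * D%:Z by apply: (@sq_neq_32mod64 (s - 3) D); lia.
have := diff_multE alpha_prim cardF zp (oner_neq0 F).
rewrite invr1; under eq_bigr do rewrite (chi1 alpha_prim cardF zp) mul1r.
rewrite !big_ord_recr big_ord0 /= (class_char_sum0 alpha_prim cardF) add0r.
move/(congr1 (fun x => 8 * x)); rewrite !mulrDr !S //= ts rmorphN /= -/D => E.
apply: (@intr_inj algC); rewrite -sq.
have -> : (64 * D%:Z)%:~R = 8 * (8 * D%:R) :> algC by ring.
by rewrite E !rmorphB /= -pmulrn q1; ring.
Qed.

End SemiprimitiveSums.

(** * The case where -1 is not in the class *)

Section OddIndex.

Variables (F : finFieldType) (alpha : {unit F}).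
Hypothesis alpha_prim : primitive_element alpha.
Variables (e f h : nat).
Hypothesis cardF : #|F|.-1 = (e * f)%N.
Hypothesis e2h : e = (2 * h)%N.
Hypothesis F2 : 2 != 0 :> F.
Hypothesis f_odd : odd f.
Variables (R : numFieldType) (zeta : R).
Hypothesis zeta_prim : e.-primitive_root zeta.

Local Notation a := (FinRing.uval alpha).
Local Notation C := (cyclotomic_class0 alpha e).
Local Notation chi := (chi alpha zeta).
Local Notation jacobi := (jacobi alpha zeta).

Lemma chiN1_odd i : chi i (-1) = (-1) ^+ i.
Proof.
have -> : -1 = a ^+ (h * f) :> F.
  apply/eqP; rewrite eq_sym.
  have : (a ^+ (h * f)) ^+ 2 == 1.
    by rewrite -exprM mulnC mulnA -e2h -cardF prim_exp_card.
  rewrite sqrf_eq1 => /orP[|//].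
  rewrite -(expr0 a) (prim_expr_eq alpha_prim) mod0n cardF e2h.
  have h0 := h_gt0 alpha_prim cardF e2h; have f0 := f_gt0 alpha_prim cardF.
  by rewrite modn_small ?muln_eq0 ?eqn0Ngt ?h0 ?f0 // ltn_pmul2r // mul2n -addnn
     -[X in (X < _)%N]addn0 ltn_add2l.
rewrite (chi_exp alpha_prim cardF zeta_prim) mulnCA exprM.
rewrite (zeta_half alpha_prim cardF zeta_prim e2h).
by rewrite -[LHS]signr_odd oddM f_odd andbT signr_odd.
Qed.

Lemma jacobi_refl_odd i j k : (e %| i + j + k)%N ->
  jacobi i j = (-1) ^+ i * jacobi i k.
Proof. by move=> E; rewrite (jacobi_refl alpha_prim cardF zeta_prim E) chiN1_odd. Qed.

Lemma jacobi_inv_odd i j : (e %| i + j)%N -> ~~ (e %| i)%N ->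
  jacobi i j = - (-1) ^+ i.
Proof.
by move=> ij ni; rewrite (jacobi_inv alpha_prim cardF zeta_prim ij ni) chiN1_odd.
Qed.

Lemma odd_jacobi_sum j : (1 < e)%N -> is_pds C -> ~~ (e %| j)%N ->
  \sum_(k < e) jacobi k j = 0.
Proof.
move=> e1 [v [k [l [mu P]]]] ej.
rewrite -(class_char_sumE alpha_prim cardF zeta_prim).
rewrite (pds_class_char_sum alpha_prim cardF zeta_prim P ej).
by rewrite (pds_odd alpha_prim cardF e2h F2 f_odd P) subrr mulr0.
Qed.

Lemma chi_half_sign x : exists b : int, chi h x = b%:~R.
Proof.
have [->|x0] := eqVneq x 0; first by exists 0; rewrite chi0.
have [i ->] := prim_exp_surj alpha_prim x0; exists ((-1) ^+ i).
rewrite (chi_exp alpha_prim cardF zeta_prim) exprM.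
by rewrite (zeta_half alpha_prim cardF zeta_prim e2h) rmorphXn rmorphN.
Qed.

(** Since [chi h] takes integer values, a combination of conjugate Jacobi sums whose coefficients
    [u] are integer multiples of [w] is one too. This replaces the arithmetic of cyclotomic
    integers; [w] will be twice a square root of -1 or of -2. *)
Lemma sum_int_mul (w : R) (u : F -> R) :
    (forall x, x != 0 -> exists b : int, u x = w * b%:~R) -> u 0 = 0 ->
  exists B : int, \sum_x u x * chi h (1 - x) = w * B%:~R.
Proof.
move=> Hu u0; apply: (big_ind (fun y => exists B : int, y = w * B%:~R)).
- by exists 0; rewrite mulr0.
- by move=> _ _ [B ->] [B' ->]; exists (B + B'); rewrite rmorphD mulrDr.
move=> x _; have [->|x0] := eqVneq x 0; first by exists 0; rewrite u0 mul0r mulr0.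
have [b ->] := Hu x x0; have [b' ->] := chi_half_sign (1 - x).
by exists (b * b'); rewrite rmorphM mulrA.
Qed.

End OddIndex.

Lemma root4_diff (R : numFieldType) (w : R) k : w ^+ 2 = -1 ->
  exists b : int, w ^+ k - w ^+ (3 * k) = 2 * w * b%:~R.
Proof.
move=> w2; have w4 : w ^+ 4 = 1 by rewrite (exprM w 2 2) w2; ring.
have red n : w ^+ n = w ^+ (n %% 4).
  by rewrite {1}(divn_eq n 4) exprD mulnC exprM w4 expr1n mul1r.
have w3 : w ^+ 3 = - w by rewrite exprS w2 mulrN1.
rewrite red [w ^+ (3 * k)]red -modnMmr.
have := ltn_pmod k (isT : 0 < 4)%N; case: (k %% 4)%N => [|[|[|[|//]]]] _ /=.
- by exists 0; rewrite !expr0; ring.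
- by exists 1; rewrite /= w3 expr1; ring.
- by exists 0; rewrite /= w2; ring.
- by exists (-1); rewrite /= w3 expr1; ring.
Qed.

(** The signs are those of the quadratic character modulo 8 that is 1 at 1 and 3, and [w + w ^+ 3]
    is a square root of -2. *)
Lemma root8_diff (R : numFieldType) (w : R) k : w ^+ 4 = -1 ->
  exists b : int, w ^+ k + w ^+ (3 * k) - w ^+ (5 * k) - w ^+ (7 * k)
    = 2 * (w + w ^+ 3) * b%:~R.
Proof.
move=> w4; have w8 : w ^+ 8 = 1 by rewrite (exprM w 4 2) w4; ring.
have red n : w ^+ n = w ^+ (n %% 8).
  by rewrite {1}(divn_eq n 8) exprD mulnC exprM w8 expr1n mul1r.
have w5 : w ^+ 5 = - w by rewrite exprS w4 mulrN1.
have w6 : w ^+ 6 = - w ^+ 2 by rewrite (exprD w 4 2) w4 mulN1r.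
have w7 : w ^+ 7 = - w ^+ 3 by rewrite (exprD w 4 3) w4 mulN1r.
rewrite red [w ^+ (3 * k)]red [w ^+ (5 * k)]red [w ^+ (7 * k)]red.
rewrite -(modnMmr 3) -(modnMmr 5) -(modnMmr 7).
have := ltn_pmod k (isT : 0 < 8)%N.
case: (k %% 8)%N => [|[|[|[|[|[|[|[|//]]]]]]]] _.
- by exists 0; rewrite /= !expr0; ring.
- by exists 1; rewrite /= w5 w7 expr1; ring.
- by exists 0; rewrite /= w6; ring.
- by exists 1; rewrite /= w5 w7 expr1; ring.
- by exists 0; rewrite /= w4; ring.
- by exists (-1); rewrite /= w5 w7 expr1; ring.
- by exists 0; rewrite /= w6; ring.
- by exists (-1); rewrite /= w5 w7 expr1; ring.
Qed.

(** If [w = 1], then [J = J' = 1/2] and [4 q = 1]. Otherwise [w] is a primitive cube root of unity,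
    the two equations add up to [J + J' = 4], and the solution [J = 1 - 2 w], [J' = 3 + 2 w] has
    product 7. *)
Lemma jacobi6_system (R : numFieldType) (w J J' : R) (q : nat) :
  w ^+ 3 = 1 -> J * J' = q%:R ->
  -2 + 2 * J + w * (J + J') = 0 -> -2 + 2 * J' + w ^+ 2 * (J + J') = 0 ->
  q = 7%N.
Proof.
move=> w3 N S2 S4.
have n2 : 2 != 0 :> R by rewrite pnatr_eq0.
have z0 (x y : R) : x - y = 0 -> x = y by move/eqP; rewrite subr_eq0 => /eqP.
have : (w - 1) * (w ^+ 2 + w + 1) = 0.
  by transitivity (w ^+ 3 - 1); [ring|rewrite w3 subrr].
move/eqP; rewrite mulf_eq0 subr_eq0 => /orP[]/eqP => [w1|ww].
  rewrite w1 in S2 S4.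
  have E : J' = J.
    apply: (mulfI n2); apply: z0.
    transitivity ((-2 + 2 * J' + 1 ^+ 2 * (J + J')) - (-2 + 2 * J + 1 * (J + J'))).
      by ring.
    by rewrite S2 S4 subrr.
  have J2 : 2 * J = 1 by apply: (mulfI n2); apply: z0; rewrite -S2 E; ring.
  have : (4 * q)%:R = 1%:R :> R.
    rewrite natrM -N E; transitivity ((2 * J) ^+ 2); first by ring.
    by rewrite J2 expr1n.
  by move/eqP; rewrite eqr_nat; lia.
have w2 : w ^+ 2 = - w - 1 by apply: z0; rewrite -ww; ring.
have T : J + J' = 4.
  apply: z0; rewrite -[RHS](addr0 0) -{1}S2 -S4 w2; ring.
rewrite T in S2 S4; rewrite w2 in S4.
have JE : J = 1 - 2 * w by apply: (mulfI n2); apply: z0; rewrite -S2; ring.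
have JE' : J' = 3 + 2 * w by apply: (mulfI n2); apply: z0; rewrite -S4; ring.
apply/eqP; rewrite -(eqr_nat R) -N JE JE'; apply/eqP.
transitivity (3 - 4 * w - 4 * w ^+ 2); first by ring.
by rewrite w2; ring.
Qed.

(** * Consequences of the vanishing sums for e = 4, 6, 8 *)

Section OddCases.

Variables (F : finFieldType) (alpha : {unit F}).
Hypothesis alpha_prim : primitive_element alpha.
Variable f : nat.
Hypothesis F2 : 2 != 0 :> F.
Hypothesis f_odd : odd f.

Local Notation C := (cyclotomic_class0 alpha).

(** Put [K = J(1, 2)] and [K' = J(3, 2)]. The vanishing of S_2 gives [K + K' = 2], the norm relation
    [K K' = q], and [K - K'] is [2 B] times a square root of -1; compare
    [4 q = (K + K') ^+ 2 - (K - K') ^+ 2]. *)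
Lemma odd_pds4 : #|F|.-1 = (4 * f)%N -> is_pds (C 4) ->
  exists B : int, #|F|%:Z = 1 + B ^+ 2.
Proof.
move=> cardF P; have [zeta zp] := C_prim_root_exists (isT : 0 < 4)%N.
have e2h : (4 = 2 * 2)%N by [].
have z2 := zeta_half alpha_prim cardF zp e2h.
have := odd_jacobi_sum alpha_prim cardF e2h F2 f_odd zp isT P (isT : ~~ (4 %| 2)%N).
rewrite !big_ord_recr big_ord0 /= (jacobi0 alpha_prim cardF zp) //.
rewrite (@jacobi_inv_odd _ _ alpha_prim 4 f 2 cardF e2h f_odd _ _ zp 2 2) // expr2
  mulrNN mulr1.
have := @jacobi_norm _ _ alpha_prim _ _ cardF _ _ zp 1 2 3 2 isT isT isT isT isT.
have [B EB] : exists B : int, jacobi alpha zeta 1 2 - jacobi alpha zeta 3 2 = 2 *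
  zeta * B%:~R.
  rewrite /jacobi -sumrB; under eq_bigr do rewrite -mulrBl.
  apply: (sum_int_mul alpha_prim cardF e2h zp); last by rewrite !chi0 subr0.
  move=> x x0; have [i ->] := prim_exp_surj alpha_prim x0.
  by rewrite !(chi_exp alpha_prim cardF zp) mul1n; apply: root4_diff.
move: (jacobi _ _ 1 2) (jacobi _ _ 3 2) EB => K K' EB N S.
exists B; apply: (@intr_inj algC); rewrite -pmulrn -N rmorphD rmorphXn /=.
have E2 : (K - K') ^+ 2 = - (4 * B%:~R ^+ 2).
  by rewrite EB !exprMn z2; ring.
have KE : K' = 2 - K by apply/eqP; rewrite -subr_eq0; apply/eqP; rewrite -S; ring.
rewrite KE in E2 *.
have n4 : 4 != 0 :> algC by rewrite pnatr_eq0.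
apply: (mulfI n4); rewrite [RHS]mulrDr -(opprK (4 * B%:~R ^+ 2)) -E2; ring.
Qed.

Lemma odd_pds6 : #|F|.-1 = (6 * f)%N -> is_pds (C 6) -> #|F| = 7%N.
Proof.
move=> cardF P; have [zeta zp] := C_prim_root_exists (isT : 0 < 6)%N.
have e2h : (6 = 2 * 3)%N by [].
have S := odd_jacobi_sum alpha_prim cardF e2h F2 f_odd zp isT P.
have Jr := jacobi_refl_odd alpha_prim cardF e2h f_odd zp.
have Ji := jacobi_inv_odd alpha_prim cardF e2h f_odd zp.
have J0 := jacobi0 alpha_prim cardF zp.
have Jd i := jacobi_diag alpha_prim cardF zp e2h F2 (i := i).
have Jc := jacobiC alpha zeta.
have N := @jacobi_norm _ _ alpha_prim _ _ cardF _ _ zp 2 3 4 3 isT isT isT isT isT.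
(* The reflection and diagonal relations reduce all sums needed to [J(2, 3)], [J(4, 3)] and this
   value of the cubic character at 2. *)
pose w := chi alpha zeta 2 2.
have c4 i : chi alpha zeta i 4 = chi alpha zeta (i * 2) 2.
  by rewrite (chi_mulX alpha_prim cardF zp) //; congr (chi _ _ _ _); ring.
have w3 : w ^+ 3 = 1.
  by rewrite /w -(chi_idxX _ _ 2 2) // (chi_dvd _ zp _ (isT : 6 %| 2 * 3)%N) F2.
have c24 : chi alpha zeta 2 4 = w ^+ 2 by rewrite c4 -chi_idxX.
have c44 : chi alpha zeta 4 4 = w.
  by rewrite c4; apply: (chi_mod _ zp).
have c14 : chi alpha zeta 1 4 = w by rewrite c4.
have c54 : chi alpha zeta 5 4 = w ^+ 2.
  by rewrite c4 -chi_idxX //; apply: (chi_mod _ zp).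
have w0 : w != 0 by rewrite (chi_neq0 _ zp).
set J := jacobi alpha zeta 2 3 in N; set J' := jacobi alpha zeta 4 3 in N.
have J12 : jacobi alpha zeta 1 2 = J by rewrite Jc (Jr 2 1 3)%N // -signr_odd mul1r.
have J22 : jacobi alpha zeta 2 2 = w * J.
  by rewrite /J -(Jd 2%N) // c24 mulrA -exprS w3 mul1r.
have J53 : jacobi alpha zeta 5 3 = - J'.
  by rewrite Jc (Jr 3 5 4)%N // -signr_odd expr1 mulN1r Jc.
have J55 : jacobi alpha zeta 5 5 = - w * J'.
  by rewrite mulNr -mulrN -J53 -(Jd 5%N) // c54 mulrA -exprS w3 mul1r.
have J52 : jacobi alpha zeta 5 2 = w * J'.
  by rewrite (Jr 5 2 5)%N // -signr_odd expr1 mulN1r J55 mulNr opprK.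
have J54 : jacobi alpha zeta 5 4 = J'.
  by rewrite Jc (Jr 4 5 3)%N // -signr_odd mul1r.
have J44 : jacobi alpha zeta 4 4 = w ^+ 2 * J'.
  by rewrite /J' -(Jd 4%N) // c44 mulrA -exprSr w3 mul1r.
have J13 : jacobi alpha zeta 1 3 = - J.
  by rewrite Jc (Jr 3 1 2)%N // -signr_odd expr1 mulN1r Jc.
have J11 : jacobi alpha zeta 1 1 = - w ^+ 2 * J.
  by rewrite mulNr -mulrN -J13 -(Jd 1%N) // c14 mulrA -exprSr w3 mul1r.
have J14 : jacobi alpha zeta 1 4 = w ^+ 2 * J.
  by rewrite (Jr 1 4 1)%N // expr1 mulN1r J11 mulNr opprK.
have S2 : -2 + 2 * J + w * (J + J') = 0.
  have := S 2%N isT; rewrite !big_ord_recr big_ord0 /= J0 // J12 J22 (Jc 3%N) (Ji 4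
    2)%N // J52.
  by rewrite -signr_odd expr0 -/J => <-; ring.
have S4 : -2 + 2 * J' + w ^+ 2 * (J + J') = 0.
  have := S 4%N isT; rewrite !big_ord_recr big_ord0 /= J0 // J14 J44 (Jc 3%N) (Ji 2
    4)%N // J54.
  by rewrite -signr_odd expr0 -/J' => <-; ring.
exact: jacobi6_system w3 N S2 S4.
Qed.

(** S_2, S_4 and S_6 suffice. With [Q = J(2, 4)], [K = J(1, 4)] and their conjugates they give
    [Q + Q' = 6] and [K + K' = -2]; as [Q - Q'] and [K - K'] are integer multiples of [2 sqrt(-1)]
    and [sqrt(-2)], the norms yield the two equations. *)
Lemma odd_pds8 : #|F|.-1 = (8 * f)%N -> is_pds (C 8) ->
  (exists B : int, #|F|%:Z = 9 + B ^+ 2) /\ (exists B : int, 2 * #|F|%:Z = 2 + B ^+ 2).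
Proof.
move=> cardF P; have [zeta zp] := C_prim_root_exists (isT : 0 < 8)%N.
have e2h : (8 = 2 * 4)%N by [].
have z4 := zeta_half alpha_prim cardF zp e2h.
have S := odd_jacobi_sum alpha_prim cardF e2h F2 f_odd zp isT P.
have Jr := jacobi_refl_odd alpha_prim cardF e2h f_odd zp.
have Ji := jacobi_inv_odd alpha_prim cardF e2h f_odd zp.
have J0 := jacobi0 alpha_prim cardF zp.
have Jd i := jacobi_diag alpha_prim cardF zp e2h F2 (i := i).
have Jc := jacobiC alpha zeta.
have NP := @jacobi_norm _ _ alpha_prim _ _ cardF _ _ zp 2 4 6 4 isT isT isT isT isT.
have NK := @jacobi_norm _ _ alpha_prim _ _ cardF _ _ zp 1 4 7 4 isT isT isT isT isT.
have [B EB] : exists B : int, jacobi alpha zeta 2 4 - jacobi alpha zeta 6 4 = 2 *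
  zeta ^+ 2 * B%:~R.
  rewrite /jacobi -sumrB; under eq_bigr do rewrite -mulrBl.
  apply: (sum_int_mul alpha_prim cardF e2h zp); last by rewrite !chi0 subr0.
  move=> x x0; have [i ->] := prim_exp_surj alpha_prim x0.
  have [b Eb] := @root4_diff _ (zeta ^+ 2) i (etrans (esym (exprM _ 2 2)) z4).
  by exists b; rewrite !(chi_exp alpha_prim cardF zp) -Eb -!exprM mulnA.
have [D ED] : exists D : int, jacobi alpha zeta 1 4 + jacobi alpha zeta 3 4 -
    jacobi alpha zeta 5 4 - jacobi alpha zeta 7 4 = 2 * (zeta + zeta ^+ 3) * D%:~R.
  rewrite /jacobi -big_split -!sumrB /=; under eq_bigr do rewrite -mulrDl -!mulrBl.
  apply: (sum_int_mul alpha_prim cardF e2h zp); last by rewrite !chi0 !subr0 addr0.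
  move=> x x0; have [i ->] := prim_exp_surj alpha_prim x0.
  by rewrite !(chi_exp alpha_prim cardF zp) mul1n; apply: root8_diff.
pose c := chi alpha zeta 1 4.
have cX i : (0 < i)%N -> chi alpha zeta i 4 = c ^+ i.
  by move=> i0; rewrite -chi_idxX // mul1n.
(* [2 = (w + 1 / w) ^ 2] for a primitive eighth root of unity [w] of [F]. *)
have c2 : c ^+ 2 = 1.
  rewrite -cX //; pose w := (FinRing.uval alpha) ^+ f.
  have w0 : w != 0 by rewrite expf_neq0 // prim_neq0.
  have w4 : w ^+ 4 = -1.
    have /eqP : (w ^+ 4) ^+ 2 = 1.
      by rewrite -exprM /w -exprM (mulnC f) -cardF prim_exp_card.
    rewrite sqrf_eq1 => /orP[|/eqP //]; rewrite /w -exprM -(expr0 (FinRing.uval alpha)).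
    rewrite (prim_expr_eq alpha_prim) mod0n cardF modn_small; last first.
      by rewrite mulnC ltn_pmul2r // odd_gt0.
    by rewrite muln_eq0 orbF eqn0Ngt odd_gt0.
  have y2 : (w + w^-1) ^+ 2 = 2.
    have -> : (w + w^-1) ^+ 2 = 2 + (w ^+ 4 + 1) / w ^+ 2 by field.
    by rewrite w4 addNr mul0r addr0.
  have y0 : w + w^-1 != 0 by apply: contraNneq F2 => y0; rewrite -y2 y0 expr0n.
  have -> : 4 = (w + w^-1) ^+ 4 by rewrite (exprM _ 2 2) y2; ring.
  by rewrite -(chi_mulX alpha_prim cardF zp) // (chi_dvd _ zp) ?y0.
have c3 : c ^+ 3 = c by rewrite exprS c2 mulr1.
have c5 : c ^+ 5 = c by rewrite (exprD c 2 3) c2 c3 mul1r.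
have c7 : c ^+ 7 = c by rewrite (exprD c 2 5) c2 c5 mul1r.
have cc x y : c * x = y -> x = c * y by move=> <-; rewrite mulrA -expr2 c2 mul1r.
set Q := jacobi alpha zeta 2 4 in NP EB; set Q' := jacobi alpha zeta 6 4 in NP EB.
set K := jacobi alpha zeta 1 4 in NK ED; set K' := jacobi alpha zeta 7 4 in NK ED.
have J15 : jacobi alpha zeta 1 5 = c * Q.
  apply: cc; exact: (jacobi_double alpha_prim cardF zp e2h F2 (isT : ~~ (8 %| 1 *
    2)%N) isT).
have J73 : jacobi alpha zeta 7 3 = c * Q'.
  apply: cc; rewrite -{1}c7 -cX //.
  have := jacobi_double alpha_prim cardF zp e2h F2 (isT : ~~ (8 %| 7 * 2)%N) isT.
  rewrite (@jacobi_mod _ alpha _ _ _ zp (7 * 2) 6 4 4) // /Q' => <-; congr (_ * _).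
  by apply: (jacobi_mod alpha zp).
have J12 : jacobi alpha zeta 1 2 = - (c * Q) by rewrite (Jr 1 2 5)%N // J15 expr1 mulN1r.
have J22 : jacobi alpha zeta 2 2 = Q by rewrite (Jr 2 2 4)%N // -signr_odd mul1r.
have J34 : jacobi alpha zeta 3 4 = K.
  by rewrite Jc (Jr 4 3 1)%N // -signr_odd mul1r Jc.
have J54 : jacobi alpha zeta 5 4 = K'.
  by rewrite Jc (Jr 4 5 7)%N // -signr_odd mul1r Jc.
have J33 : jacobi alpha zeta 3 3 = c * K by apply: cc; rewrite -{1}c3 -cX // Jd.
have J32 : jacobi alpha zeta 3 2 = - (c * K).
  by rewrite (Jr 3 2 3)%N // J33 -signr_odd mulN1r.
have J52 : jacobi alpha zeta 5 2 = - (c * Q).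
  by rewrite Jc (Jr 2 5 1)%N // Jc J12 -signr_odd mul1r.
have J77 : jacobi alpha zeta 7 7 = c * K' by apply: cc; rewrite -{1}c7 -cX // Jd.
have J72 : jacobi alpha zeta 7 2 = - (c * K').
  by rewrite (Jr 7 2 7)%N // J77 -signr_odd mulN1r.
have J11 : jacobi alpha zeta 1 1 = c * K by apply: cc; rewrite Jd.
have J16 : jacobi alpha zeta 1 6 = - (c * K) by rewrite (Jr 1 6 1)%N // J11 expr1 mulN1r.
have J76 : jacobi alpha zeta 7 6 = - (c * Q').
  by rewrite (Jr 7 6 3)%N // J73 -signr_odd mulN1r.
have J36 : jacobi alpha zeta 3 6 = - (c * Q').
  by rewrite Jc (Jr 6 3 7)%N // Jc J76 -signr_odd mul1r.
have J55 : jacobi alpha zeta 5 5 = c * K' by apply: cc; rewrite -{1}c5 -cX // Jd.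
have J56 : jacobi alpha zeta 5 6 = - (c * K').
  by rewrite (Jr 5 6 5)%N // J55 -signr_odd mulN1r.
have J66 : jacobi alpha zeta 6 6 = Q' by rewrite (Jr 6 6 4)%N // -signr_odd mul1r.
have S2 : -2 - 2 * c * Q + 2 * Q - c * (K + K') = 0.
  have := S 2%N isT; rewrite !big_ord_recr big_ord0 /= J0 // J12 J22 J32 (Jc 4%N) J52
    (Ji 6 2)%N // J72.
  by rewrite -signr_odd expr0 -/Q => <-; ring.
have S6 : -2 - 2 * c * Q' + 2 * Q' - c * (K + K') = 0.
  have := S 6%N isT; rewrite !big_ord_recr big_ord0 /= J0 // J16 (Ji 2 6)%N // J36
    (Jc 4%N) J56 J66 J76.
  by rewrite -signr_odd expr0 -/Q' => <-; ring.
have S4 : -2 + 2 * (K + K') + (Q + Q') = 0.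
  have := S 4%N isT; rewrite !big_ord_recr big_ord0 /= J0 // J34 J54 (Ji 4 4)%N //.
  by rewrite -signr_odd expr0 -/Q -/Q' -/K -/K' => <-; ring.
have n2 : 2 != 0 :> algC by rewrite pnatr_eq0.
have n4 : 4 != 0 :> algC by rewrite pnatr_eq0.
have z0 (x y : algC) : x - y = 0 -> x = y by move/eqP; rewrite subr_eq0 => /eqP.
(* For [c = -1] the three sums force [Q = Q' = 1/3], hence [9 q = 1]. *)
have /eqP := c2; rewrite sqrf_eq1 => /orP[]/eqP c1; rewrite c1 in S2 S6; last first.
  have QE : Q' = Q.
    by apply: (mulfI n4); apply: z0; rewrite -[RHS](subrr 0) -{1}S6 -S2; ring.
  have Q3 : 3 * Q = 1.
    apply: (mulfI n2); apply: z0; rewrite QE in S4.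
    have -> : 2 * (3 * Q) - 2 * 1 = 2 * (-2 - 2 * -1 * Q + 2 * Q - -1 * (K + K')) -
      (-2 + 2 * (K + K') + (Q + Q)) by ring.
    by rewrite S2 S4; ring.
  have : (9 * #|F|)%:R = 1%:R :> algC.
    rewrite natrM -NP QE; transitivity ((3 * Q) ^+ 2); first by ring.
    by rewrite Q3 expr1n.
  by move/eqP; rewrite eqr_nat; lia.
have T : K + K' = -2 by apply: z0; rewrite -[RHS]oppr0 -S2; ring.
have U : Q' = 6 - Q by apply: z0; rewrite -S4 T; ring.
have KE : K' = -2 - K by apply: z0; rewrite -[RHS](subrr (-2)) -{1}T; ring.
split.
  exists B; apply: (@intr_inj algC); rewrite -pmulrn -NP rmorphD rmorphXn /=.
  have E2 : (Q - Q') ^+ 2 = - (4 * B%:~R ^+ 2).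
    by rewrite EB; transitivity (4 * zeta ^+ 4 * B%:~R ^+ 2); [ring|rewrite z4; ring].
  rewrite U in E2 *.
  apply: (mulfI n4); rewrite [RHS]mulrDr -(opprK (4 * B%:~R ^+ 2)) -E2; ring.
exists D; apply: (@intr_inj algC).
have -> : (2 * #|F|%:Z)%:~R = 2 * #|F|%:R :> algC by ring.
have -> : (2 + D ^+ 2)%:~R = 2 + D%:~R ^+ 2 :> algC by ring.
rewrite -NK.
have E2 : (2 * (K - K')) ^+ 2 = - (8 * D%:~R ^+ 2).
  have -> : 2 * (K - K') = 2 * (zeta + zeta ^+ 3) * D%:~R by rewrite -ED J34 J54; ring.
  have -> : (2 * (zeta + zeta ^+ 3) * D%:~R) ^+ 2 =
     4 * (zeta ^+ 2 + 2 * zeta ^+ 4 + zeta ^+ 4 * zeta ^+ 2) * D%:~R ^+ 2 by ring.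
  by rewrite z4; ring.
rewrite KE in E2 *.
have n8 : 8 != 0 :> algC by rewrite pnatr_eq0.
apply: (mulfI n8); rewrite [RHS]mulrDr -(opprK (8 * D%:~R ^+ 2)) -E2; ring.
Qed.

End OddCases.

(** * Quadratic representations of prime powers *)

Lemma Posz_exp (p m : nat) : (p ^ m)%N%:Z = p%:Z ^+ m.
Proof. by rewrite -!natz natrX. Qed.

Lemma dvdz_prime_sqr (p : nat) (x : int) : prime p ->
  (p%:Z %| x ^+ 2)%Z -> (p%:Z %| x)%Z.
Proof. by move=> pp; rewrite !dvdzE abszX Euclid_dvdX // => /andP[]. Qed.

(** [q] divides [D (x v - y u) (x v + y u)] and [p] does not divide both factors, so [q] divides one
    of them, say [x v - y u] after a change of sign of [v]. In [q ^+ 2 = (x u + D y v) ^+ 2 + D (x v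
    - y u) ^+ 2] the last term must then vanish, because [D >= 2]. *)
Lemma repr_unique (p m : nat) (D x y u v : int) : prime p -> odd p -> (0 < m)%N ->
    2 <= D -> ~~ (p%:Z %| D)%Z -> ~~ (p%:Z %| x)%Z -> ~~ (p%:Z %| u)%Z ->
    p%:Z ^+ m = x ^+ 2 + D * y ^+ 2 -> p%:Z ^+ m = u ^+ 2 + D * v ^+ 2 ->
  x = u \/ x = - u.
Proof.
move=> pp op m0 D2 pD px pu.
have cop (z : int) : coprimez p z = ~~ (p%:Z %| z)%Z.
  by rewrite coprimezE dvdzE prime_coprime.
have pq : (p%:Z %| p%:Z ^+ m)%Z by rewrite dvdz_exp.
set q := p%:Z ^+ m in pq *.
have q0 : 0 < q by rewrite exprn_gt0 // ltz_nat prime_gt0.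
move=> E1 E2.
wlog dv : v E2 / (q %| x * v - y * u)%Z => [H|].
  have E : D * ((x * v - y * u) * (x * v + y * u)) = q * (x ^+ 2 - u ^+ 2).
    transitivity (x ^+ 2 * (D * v ^+ 2) - D * y ^+ 2 * u ^+ 2); first by ring.
    have -> : D * v ^+ 2 = q - u ^+ 2 by rewrite E2; ring.
    have -> : D * y ^+ 2 = q - x ^+ 2 by rewrite E1; ring.
    by ring.
  have dvd : (q %| (x * v - y * u) * (x * v + y * u))%Z.
    rewrite -(@Gauss_dvdzr _ D); last by rewrite /q coprimezXl // cop.
    by rewrite E dvdz_mulr.
  have [d1|d1] := boolP (p%:Z %| x * v - y * u)%Z; last first.
    apply: (H (- v)); first by rewrite sqrrN.
    rewrite -(@Gauss_dvdzr _ (x * v - y * u)) ?coprimezXl ?cop //.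
    have -> : x * - v - y * u = - (x * v + y * u) by ring.
    by rewrite mulrN rpredN.
  apply: (H v) => //.
  rewrite -(@Gauss_dvdzl _ _ (x * v + y * u)) ?coprimezXl ?cop //.
  (* Dividing both factors, [p] would divide [2 x v], hence [v], hence [u]. *)
  apply/negP => d2; have := rpredD d1 d2.
  have -> : x * v - y * u + (x * v + y * u) = (2 * x) * v by ring.
  rewrite Gauss_dvdzr; last first.
    rewrite cop dvdzE abszM Euclid_dvdM // negb_or -!dvdzE px andbT dvdzE gtnNdvd //.
    by case: (p) pp op => [|[|[|]]].
  move=> pv; case/negP: pu; apply: dvdz_prime_sqr => //.
  have -> : u ^+ 2 = q - D * v ^+ 2 by rewrite E2; ring.
  by rewrite rpredB // dvdz_mull // dvdz_exp.
case/dvdzP: dv => k Ek.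
have E : q ^+ 2 = (x * u + D * y * v) ^+ 2 + D * (x * v - y * u) ^+ 2.
  by rewrite expr2 {1}E1 E2; ring.
have k0 : k = 0.
  apply/eqP; apply/negPn/negP => k0.
  have k1 : 1 <= k ^+ 2 by rewrite -gtz0_ge1 exprn_even_gt0.
  rewrite Ek exprMn in E; have := sqr_ge0 (x * u + D * y * v).
  have : 0 < q ^+ 2 by rewrite exprn_gt0.
  move: E; move: (q ^+ 2) (k ^+ 2) k1 ((_ + _) ^+ 2) => Q k2 k21 Z E Q0 Z0.
  have h1 : Q <= k2 * Q by rewrite ler_peMl // ltW.
  have h2 : 2 * (k2 * Q) <= D * (k2 * Q).
    by rewrite ler_wpM2r // mulr_ge0 // ?(le_trans _ k21) // ltW.
  move: (k2 * Q) h1 h2 E => A h1 h2 E; move: (D * A) h2 E => B h2 E.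
  by clear - Q0 Z0 h1 h2 E; lia.
have xu : x ^+ 2 = u ^+ 2.
  rewrite k0 mul0r in Ek.
  have E0 : q * (x ^+ 2 - u ^+ 2) = 0.
    transitivity (x ^+ 2 * (q - u ^+ 2) - (q - x ^+ 2) * u ^+ 2); first by ring.
    have -> : q - u ^+ 2 = D * v ^+ 2 by rewrite E2; ring.
    have -> : q - x ^+ 2 = D * y ^+ 2 by rewrite E1; ring.
    transitivity (D * (x * v - y * u) * (x * v + y * u)); first by ring.
    by rewrite Ek; ring.
  move/eqP: E0; rewrite mulf_eq0 (gt_eqF q0) /= subr_eq0 => /eqP //.
by move/eqP: xu; rewrite eqf_sqr => /orP[]/eqP ->; [left|right].
Qed.

(** Shows that the second coordinate of a proper representation is nonzero; [c] is 4 for [e = 3] and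
    1 otherwise. *)
Lemma repr_neq0 (p m : nat) (c x : int) : prime p -> (0 < m)%N ->
  ~~ (p%:Z %| x)%Z -> c * p%:Z ^+ m = x ^+ 2 -> False.
Proof.
move=> pp m0 px E; case/negP: px; apply: dvdz_prime_sqr => //.
by rewrite -E dvdz_mull // dvdz_exp.
Qed.

Lemma exp_modN1 p e m : (1 < e)%N -> (p %% e = e.-1)%N ->
  (p ^ m %% e = if odd m then e.-1 else 1)%N.
Proof.
move=> e1 pe; elim: m => [|m IH]; first by rewrite expn0 modn_small.
rewrite expnS -modnMm IH pe /=; case: (odd m) => /=; last first.
  by rewrite muln1 modn_small //; lia.
case: e e1 {pe IH} => [|[|e]] // _ /=.
by rewrite (_ : (e.+1 * e.+1 = e * e.+2 + 1)%N) ?modnMDl ?modn_small //; lia.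
Qed.

(** Squares [M ^ 2 < N ^ 2] differ by at least [2 N - 1], so [N <= 5]. This treats square [q] among
    the improper octic cases. *)
Lemma sqr_9_sqr (N : nat) (B : int) : N%:Z ^+ 2 = 9 + B ^+ 2 -> (N = 3 \/ N = 5)%N.
Proof.
move=> E; have [M EM] : exists M : nat, B ^+ 2 = M%:Z ^+ 2.
  by exists `|B|%N; rewrite abszE real_normK // num_real.
rewrite EM in E; have E' : (N * N = 9 + M * M)%N by lia.
have lt : (M < N)%N by rewrite ltnNge; apply/negP => H; have := leq_mul H H; lia.
have le : (N <= 5)%N.
  by case: N {E} E' lt => // n E'; rewrite ltnS => lt; have := leq_mul lt lt; lia.
by case: N {E lt} E' le => [|[|[|[|[|[|//]]]]]]; case: M {EM} => [|[|[|[|[|M]]]]] //; lia.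
Qed.

Lemma odd_sqr_mod8 n : odd n -> (n * n %% 8 = 1)%N.
Proof.
move=> on; have := exp_mod8_odd 2 on; rewrite /= => E.
by rewrite mulnn E.
Qed.

(** * Tools common to all e, and the case e = 3 *)

Section Order3.

Variables (p m : nat) (F : finFieldType) (alpha : {unit F}).
Hypotheses (p_prime : prime p) (cardFp : #|F| = (p ^ m)%N).
Hypothesis alpha_prim : primitive_element alpha.

Local Notation q := (p ^ m)%N.
Local Notation a := (FinRing.uval alpha).
Local Notation C := (cyclotomic_class0 alpha).

Lemma m_gt0 : (0 < m)%N.
Proof. by have := finNzRing_gt1 F; rewrite cardFp; case: m. Qed.

Lemma card_pred e f : q = (e * f + 1)%N -> #|F|.-1 = (e * f)%N.
Proof. by rewrite cardFp => ->; rewrite addn1. Qed.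

Lemma two_neq0 : odd p -> 2 != 0 :> F.
Proof.
move=> op; rewrite -(dvdn_pcharf (pcharF p_prime cardFp)) gtnNdvd //.
by case: (p) p_prime op => [|[|[|]]].
Qed.

Lemma odd_prime_of_odd : odd q -> odd p.
Proof. by rewrite oddX; have := m_gt0; case: m. Qed.

Lemma sqr_half : ~~ odd m -> q = (p ^ m./2 * p ^ m./2)%N.
Proof. by move=> me; rewrite -expnD addnn even_halfK. Qed.

Lemma improper_odd e f h : q = (e * f + 1)%N -> e = (2 * h)%N -> odd p -> odd f ->
  ~ is_proper_pds (C e).
Proof.
move=> E eh op of_ [v [k [l [mu [P]]]]]; apply.
by apply: (pds_odd alpha_prim (card_pred E) eh (two_neq0 op) of_ P).
Qed.

Lemma sign_even f : ~~ odd f -> (-1) ^+ f = 1 :> F.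
Proof. by move=> ef; rewrite -signr_odd (negPf ef). Qed.

Lemma not_pds_mod1 e f : q = (e * f + 1)%N -> (2 < e)%N -> (p %% e = 1)%N ->
  ~~ odd f -> ~ is_pds (C e).
Proof.
move=> E e2 p1 ef [v [k [l [mu P]]]].
have := pds_bin2 alpha_prim (card_pred E) P e2 (sign_even ef).
move/eqP; rewrite -(dvdn_pcharf (pcharF p_prime cardFp)); apply/negP.
exact: (ndvd_bin2_mod1 p_prime (esym E) (ltnW e2)).
Qed.

Lemma not_pds_mod8 f : q = (8 * f + 1)%N ->
  [\/ p %% 8 = 1, p %% 8 = 3 | p %% 8 = 5]%N -> ~~ odd f -> ~ is_pds (C 8).
Proof.
move=> E H ef; case: H => p8; first exact: not_pds_mod1 E _ p8 ef.
  move=> [v [k [l [mu P]]]].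
  have := pds_bin2 alpha_prim (card_pred E) P isT (sign_even ef).
  move/eqP; rewrite -(dvdn_pcharf (pcharF p_prime cardFp)); apply/negP.
  exact: (ndvd_bin2_mod8 p_prime (esym E)).
move=> [v [k [l [mu P]]]].
have := pds_bin3 alpha_prim (card_pred E) P isT (sign_even ef).
have F2 : 2 != 0 :> F by apply: two_neq0; lia.
move/eqP; rewrite mulf_eq0 (negPf F2) -(dvdn_pcharf (pcharF p_prime cardFp)); apply/negP.
exact: (ndvd_bin3_mod8 p_prime (esym E)).
Qed.

(** One known parameter set characterizes all, by [pds_unique]. The comparison takes place in [rat],
    where subtraction and division are exact. *)
Lemma pds_params e f l0 mu0 (rk rl rm : rat) : q = (e * f + 1)%N -> (1 < e)%N ->
    pds (C e) q f l0 mu0 -> rk = f%:R -> rl = l0%:R -> rm = mu0%:R ->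
  forall v k l mu : nat, pds (C e) v k l mu <->
    [/\ v = q, k%:R = rk, l%:R = rl & mu%:R = rm].
Proof.
move=> E e1 P -> -> -> v k l mu.
have [_ _ El Em] := pds_unique alpha_prim (card_pred E) e1 P.
split=> [P'|].
  have [-> -> -> ->] := pds_unique alpha_prim (card_pred E) e1 P'.
  by rewrite -El -Em.
have I (x y : nat) : x%:R = y%:R :> rat -> x = y.
  by move/eqP; rewrite eqr_nat => /eqP.
by case=> -> /I -> /I -> /I ->.
Qed.

Lemma rat_eq_divn (n : nat) (N d : int) : d != 0 -> d * n%:Z = N ->
  N%:~R / d%:~R = n%:R :> rat.
Proof.
move=> d0 <-; rewrite rmorphM /= mulrAC divff ?mul1r ?intr_eq0 //.
Qed.

Lemma pds_order3 f (c d : int) : q = (3 * f + 1)%N -> rep3 p m c d ->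
  [/\ is_pds (C 3%N) <-> d = 0,
      d = 0 -> forall v k lambda mu : nat,
        pds (C 3%N) v k lambda mu <->
        [/\ v = q,
            k%:R = (q%:R - 1) / 3 :> rat,
            lambda%:R = (q%:R - 8 + c%:~R) / 9 :> rat
          & mu%:R = (2 * q%:R - 4 - c%:~R) / 18 :> rat],
      d = 0 -> ~ trivial_pds (C 3%N) -> is_proper_pds (C 3%N)
    & d = 0 <-> (p %% 3 = 2)%N /\ ~~ odd m].
Proof.
move=> E [R2 R1]; have cF := card_pred E; have m0 := m_gt0.
have : (p %% 3 = 1 \/ p %% 3 = 2)%N.
  have : ~~ (3 %| p)%N.
    by apply/negP => /(dvdn_exp m0); rewrite E; lia.
  by lia.
case=> p3.
  have [E4 pc c1] := R1 p3.
  have d0 : d <> 0.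
    by move=> d0; apply: (repr_neq0 p_prime m0 pc (c := 4)); rewrite E4 d0; ring.
  have np : ~ is_pds (C 3).
    (* For odd [p], [q = 3 f + 1] is odd and [f] is even; [p = 2] is not 1 modulo 3. *)
    apply: (not_pds_mod1 E) => //.
    case op: (odd p); first by have : odd q by [rewrite oddX op orbT]; lia.
    have := p_prime; case: (p) p3 op => [|[|[|n]]] // p3 /= on np.
    by have := @prime_oddPn n.+3 np; rewrite /= on => /(_ isT).
  by split=> //; split=> // -[]; rewrite p3.
have [d0 cN c1] := R2 p3.
have me : ~~ odd m.
  by apply/negP => om; have := exp_modN1 m (isT : 1 < 3)%N p3; rewrite om E; lia.
have [s [zeta [sN zp HA]]] := semiprimitive3 alpha_prim p_prime cardFp me cF p3.
have HA' j : (0 < j < 3)%N ->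
    3%:R * class_char_sum alpha 3 zeta j = -2 + (3%:R - 2) * s%:~R.
  by move=> /HA ->; ring.
have [P E1 Ea] := semiprimitive_pds alpha_prim cardFp cF isT zp HA'.
(* The multiplicity at 1 satisfies [9 lambda = q - 8 + 2 s], so [2 s] is 1 modulo 3, as is [c], and
   they agree up to sign. *)
have cs : c = 2 * s.
  rewrite -!Posz_exp in cN.
  move: cN sN E1; rewrite E => cN sN E1; lia.
split=> //.
- by split=> // _; exists q, f, (diff_mult (C 3) 1), (diff_mult (C 3) a).
- move=> _; apply: (pds_params E isT P).
  + by rewrite E; field.
  + rewrite -(@rat_eq_divn _ (q%:Z - 8 + c) 9) //; last by lia.
    by field.
  + rewrite -(@rat_eq_divn _ (2 * q%:Z - 4 - c) 18) //; last by lia.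
    by field.
- move=> _ nt; exists q, f, (diff_mult (C 3) 1), (diff_mult (C 3) a); split=> // eq1a.
  (* [lambda = mu] reads [q - 8 + 2 s = q - 2 - s], so [s = 2] and [q = 4]: the class is [{1}], and
     [{0, 1}] is an additive subgroup. *)
  apply: nt; left; have s2 : s = 2 by lia.
  have N2 : (p ^ m./2 = 2)%N by lia.
  have q4 : q = 4%N by rewrite (sqr_half me) N2.
  have f1 : f = 1%N by lia.
  have ch2 : 2%N \in [pchar F].
    suff <- : p = 2%N by apply: pcharF p_prime cardFp.
    have : (p %| 2)%N by rewrite -N2 dvdn_exp // half_gt0; case: (m) m0 me => [|[|]].
    by rewrite dvdn_prime2 // => /eqP.
  have C1 : C 3 = [set 1].
    apply/esym/eqP; rewrite eqEcard sub1set class1 cards1.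
    by rewrite (card_class alpha_prim cF) f1.
  rewrite C1; split; first by rewrite !inE eqxx.
  move=> x y; rewrite !inE => /orP[]/eqP -> /orP[]/eqP ->;
   by rewrite ?subrr ?subr0 ?sub0r ?(oppr_pchar2 ch2) eqxx ?orbT.
Qed.

End Order3.

Lemma ndvdz1_prime p : prime p -> ~~ (p%:Z %| 1)%Z.
Proof. by move=> /prime_gt1 p1; rewrite dvdz1; lia. Qed.

Lemma ndvdz_prime p l k : prime p -> prime l -> p <> l ->
  ~~ (p%:Z %| (l ^ k)%N%:Z)%Z.
Proof.
move=> pp lp pl; rewrite dvdzE /= Euclid_dvdX // negb_and dvdn_prime2 //.
by move/eqP: pl => ->.
Qed.

Lemma int_parity (z : int) : exists w, z = 2 * w \/ z = 2 * w + 1.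
Proof. by exists (z %/ 2)%Z; lia. Qed.

(** * The cases e = 4, 6 and 8 *)

Section Orders468.

Variables (p m : nat) (F : finFieldType) (alpha : {unit F}).
Hypotheses (p_prime : prime p) (cardFp : #|F| = (p ^ m)%N).
Hypothesis alpha_prim : primitive_element alpha.

Local Notation q := (p ^ m)%N.
Local Notation a := (FinRing.uval alpha).
Local Notation C := (cyclotomic_class0 alpha).

Lemma pds_order4 f (s t : int) : q = (4 * f + 1)%N -> rep4 p m s t ->
  [/\ is_pds (C 4%N) /\ (odd f -> s = 1 -> is_proper_pds (C 4%N)) <-> t = 0,
      t = 0 -> forall v k lambda mu : nat,
        pds (C 4%N) v k lambda mu <->
        [/\ v = q,
            k%:R = (q%:R - 1) / 4 :> rat,
            lambda%:R = (q%:R - 11 - 6 * s%:~R) / 16 :> rat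
          & mu%:R = (q%:R - 3 + 2 * s%:~R) / 16 :> rat]
    & t = 0 <-> (p %% 4 = 3)%N /\ ~~ odd m].
Proof.
move=> E [R3 R1]; have cF := card_pred cardFp E; have m0 := m_gt0 cardFp.
have op : odd p by apply: (odd_prime_of_odd cardFp); rewrite E; clear; lia.
have : (p %% 4 = 1 \/ p %% 4 = 3)%N by lia.
case=> p4.
  have [E1 ps s1] := R1 p4.
  have t0 : t <> 0.
    by move=> t0; apply: (repr_neq0 p_prime m0 ps (c := 1)); rewrite mul1r E1 t0; ring.
  have np : ~ (is_pds (C 4%N) /\ (odd f -> s = 1 -> is_proper_pds (C 4%N))).
    case=> P PP; case of_: (odd f); last first.
      by apply: (not_pds_mod1 p_prime cardFp alpha_prim E isT p4 _ P); rewrite of_.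
    have [B EB] := odd_pds4 alpha_prim (two_neq0 p_prime cardFp op) of_ cF P.
    have [b Eb] : exists b, B = 2 * b.
      have [b [Eb|Eb]] := int_parity B; first by exists b.
      by move: EB; rewrite cardFp E Eb; clear; lia.
    (* This representation is itself proper, so uniqueness gives [s = 1] or [s = -1], and [s = 1]
       modulo 4 decides. *)
    have E2 : p%:Z ^+ m = 1 ^+ 2 + 4 * b ^+ 2.
      by rewrite -Posz_exp -cardFp EB Eb; ring.
    have p1 := ndvdz1_prime p_prime.
    have pD : ~~ (p%:Z %| 4)%Z.
      by apply: (@ndvdz_prime p 2 2) => // p2; rewrite p2 in op.
    have := repr_unique p_prime op m0 (isT : 2 <= 4 :> int) pD ps p1 E1 E2.
    have s1' : s = 1 \/ s = -1 -> s = 1 by clear - s1; lia.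
    move/s1' => ss; exact: (improper_odd p_prime cardFp alpha_prim E (erefl : 4 = 2 *
      2)%N op of_ (PP of_ ss)).
  by split=> //; split=> // -[]; rewrite p4.
have [sE t0] := R3 p4.
have me : ~~ odd m.
  by apply/negP => om; have := exp_modN1 m (isT : 1 < 4)%N p4; rewrite om E; clear; lia.
(* [q] is an odd square, hence 1 modulo 8. Evenness of [f] makes the properness clause vacuous and
   supplies the power of 2 that fixes [s'] modulo 4. *)
have ef : ~~ odd f.
  have oN : odd (p ^ m./2)%N by rewrite oddX op orbT.
  by have := odd_sqr_mod8 oN; rewrite -(sqr_half p me) E; clear; lia.
have [s' [zeta [sN zp HA]]] := semiprimitive4 alpha_prim p_prime cardFp me cF p4.
have [P E1 Ea] := semiprimitive_pds alpha_prim cardFp cF isT zp HA.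
have s4 : (s = 1 %[mod 4])%Z.
  rewrite sE -modzXm; have -> : (- p%:Z %% 4)%Z = 1 by clear -p4; lia.
  by rewrite expr1n.
have sN' : s = (p ^ m./2)%N%:Z \/ s = - (p ^ m./2)%N%:Z.
  rewrite sE exprNn -signr_odd Posz_exp.
  by case: (odd _); rewrite ?expr0 ?expr1 ?mul1r ?mulN1r; [right|left].
(* [16 lambda = q - 11 + 6 s'] with [q = 1] modulo 8 gives [s' = 3] modulo 4, whereas [s = 1]. *)
have ss : s' = - s.
  have [k ef'] : exists k, f = (2 * k)%N by exists f./2; clear -ef; lia.
  by clear -E1 E sN sN' s4 ef'; move: E1 sN sN'; rewrite E ef'; lia.
split=> //.
- split=> // _; split; first by exists q, f, (diff_mult (C 4) 1), (diff_mult (C 4) a).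
  by move=> of_; rewrite of_ in ef.
- move=> _; apply: (pds_params cardFp alpha_prim E isT P).
  + by rewrite E; field.
  + rewrite -(@rat_eq_divn _ (q%:Z - 11 - 6 * s) 16) //; last by clear -E1 ss; lia.
    by field.
  + rewrite -(@rat_eq_divn _ (q%:Z - 3 + 2 * s) 16) //; last by clear -Ea ss; lia.
    by field.
Qed.

Lemma pds_order6 f (s t : int) : q = (6 * f + 1)%N -> rep6 p m s t ->
  [/\ is_pds (C 6%N) /\ (f = 1%N -> is_proper_pds (C 6%N)) <-> t = 0,
      t = 0 -> forall v k lambda mu : nat,
        pds (C 6%N) v k lambda mu <->
        [/\ v = q,
            k%:R = (q%:R - 1) / 6 :> rat,
            lambda%:R = (q%:R - 17 - 20 * s%:~R) / 36 :> rat
          & mu%:R = (q%:R - 5 + 4 * s%:~R) / 36 :> rat]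
    & t = 0 <-> (p %% 6 = 5)%N /\ ~~ odd m].
Proof.
move=> E [R3 R1]; have cF := card_pred cardFp E; have m0 := m_gt0 cardFp.
have op : odd p by apply: (odd_prime_of_odd cardFp); rewrite E; clear; lia.
have : (p %% 6 = 1 \/ p %% 6 = 5)%N.
  have : ~~ (3 %| p)%N.
    by apply/negP => /(dvdn_exp m0); rewrite E; lia.
  by lia.
case=> p6.
  have [E1 ps s1] := R1 p6.
  have t0 : t <> 0.
    by move=> t0; apply: (repr_neq0 p_prime m0 ps (c := 1)); rewrite mul1r E1 t0; ring.
  have np : ~ (is_pds (C 6%N) /\ (f = 1%N -> is_proper_pds (C 6%N))).
    case=> P PP; case of_: (odd f); last first.
      by apply: (not_pds_mod1 p_prime cardFp alpha_prim E isT p6 _ P); rewrite of_.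
    have q7 := odd_pds6 alpha_prim (two_neq0 p_prime cardFp op) of_ cF P.
    have f1 : f = 1%N by move: q7; rewrite cardFp E; clear; lia.
    exact: (improper_odd p_prime cardFp alpha_prim E (erefl : 6 = 2 * 3)%N op of_ (PP
      f1)).
  by split=> //; split=> // -[]; rewrite p6.
have [t0 sN' s3] := R3 p6.
have me : ~~ odd m.
  by apply/negP => om; have := exp_modN1 m (isT : 1 < 6)%N p6; rewrite om E; clear; lia.
have [s' [zeta [sN zp HA]]] := semiprimitive6 alpha_prim p_prime cardFp me cF p6.
have [P E1 Ea] := semiprimitive_pds alpha_prim cardFp cF isT zp HA.
(* [36 lambda = q - 17 + 20 s'] gives [s' = 2] modulo 3, whereas [s = 1]. *)
have ss : s' = - s.
  rewrite -!Posz_exp in sN'.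
  by clear -E1 E sN sN' s3; move: E1 sN sN'; rewrite E; lia.
split=> //.
- split=> // _; split; first by exists q, f, (diff_mult (C 6) 1), (diff_mult (C 6) a).
  (* [f = 1] would make the square [q] equal to 7. *)
  move=> f1; exfalso; have := sqr_half p me; rewrite E f1.
  by case: (p ^ m./2)%N => [|[|[|n]]] //; clear; lia.
- move=> _; apply: (pds_params cardFp alpha_prim E isT P).
  + by rewrite E; field.
  + rewrite -(@rat_eq_divn _ (q%:Z - 17 - 20 * s) 36) //; last by clear -E1 ss; lia.
    by field.
  + rewrite -(@rat_eq_divn _ (q%:Z - 5 + 4 * s) 36) //; last by clear -Ea ss; lia.
    by field.
Qed.

(** When both given representations are proper, uniqueness identifies them with the two coming from
    [odd_pds8]. Otherwise [m] is even, and the square [q = 9 + B ^+ 2] is 9 or 25. *)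
Lemma odd_pds8_repr f (x y a' b : int) : q = (8 * f + 1)%N ->
    [\/ p %% 8 = 1, p %% 8 = 3 | p %% 8 = 5]%N ->
    rep8_xy p m x y -> rep8_ab p m a' b -> odd f -> is_pds (C 8) ->
  x = -3 /\ a' = 1.
Proof.
move=> E p8 [x4 Rx] [a4 Ra] of_ P.
have cF := card_pred cardFp E; have m0 := m_gt0 cardFp.
have op : odd p by apply: (odd_prime_of_odd cardFp); rewrite E; clear; lia.
have p1 := ndvdz1_prime p_prime.
have [[B EB] [D ED]] := odd_pds8 alpha_prim (two_neq0 p_prime cardFp op) of_ cF P.
have [g Eg] : exists g, B = 2 * g.
  have [g [Eg|Eg]] := int_parity B; first by exists g.
  by move: EB; rewrite cardFp E Eg; clear; lia.
have [h Eh] : exists h, D = 2 * h.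
  have [h [Eh|Eh]] := int_parity D; first by exists h.
  by move: ED; rewrite cardFp E Eh; clear; lia.
have E3 : p%:Z ^+ m = 3 ^+ 2 + 4 * g ^+ 2.
  by rewrite -Posz_exp -cardFp EB Eg; ring.
have E1 : p%:Z ^+ m = 1 ^+ 2 + 2 * h ^+ 2.
  rewrite -Posz_exp -cardFp; move: ED; rewrite Eh; clear; lia.
have pD2 : ~~ (p%:Z %| 2)%Z.
  by apply: (@ndvdz_prime p 2 1) => // p2; rewrite p2 in op.
have a1 : p%:Z ^+ m = a' ^+ 2 + 2 * b ^+ 2 -> ~~ (p%:Z %| a')%Z -> a' = 1.
  move=> Ea pa.
  have := repr_unique p_prime op m0 (isT : 2 <= 2 :> int) pD2 pa p1 Ea E1.
  by clear -a4; lia.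
have me : (p %% 8 <> 1)%N -> ~~ odd m.
  by move=> H; apply/negP => om; have := exp_mod8_odd m op; rewrite om E; clear -H; lia.
have N35 : (p %% 8 <> 1)%N -> (p ^ m./2 = 3 \/ p ^ m./2 = 5)%N.
  move=> /me me'; apply: (@sqr_9_sqr _ B).
  by rewrite -EB cardFp (sqr_half p me') PoszM.
have pN : (p %% 8 <> 1)%N -> (p %| p ^ m./2)%N.
  by move=> /me me'; rewrite dvdn_exp // half_gt0; case: (m) m0 me' => [|[|]].
case: p8 => p8.
- rewrite p8 /= in Ra; have p41 : (p %% 4 == 1)%N by clear -p8; lia.
  rewrite p41 in Rx; case: Rx => Ex px; case: Ra => Ea pa.
  split; last exact: a1.
  have pD : ~~ (p%:Z %| 4)%Z.
    by apply: (@ndvdz_prime p 2 2) => // p2; rewrite p2 in op.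
  have p3 : ~~ (p%:Z %| 3)%Z.
    by apply: (@ndvdz_prime p 3 1) => // p3; rewrite p3 in p8.
  have := repr_unique p_prime op m0 (isT : 2 <= 4 :> int) pD px p3 Ex E3.
  by clear -x4; lia.
- have H : (p %% 8 <> 1)%N by rewrite p8.
  rewrite p8 /= in Ra; have p41 : (p %% 4 == 1)%N = false by clear -p8; lia.
  rewrite p41 in Rx; case: Rx => Ex y0; case: Ra => Ea pa.
  split; last exact: a1.
  rewrite -!Posz_exp in Ex.
  case: (N35 H) => N; first by rewrite N in Ex; clear -Ex x4; lia.
  have := pN H; rewrite N dvdn_prime2 // => /eqP p5; by rewrite p5 in p8.
- have H : (p %% 8 <> 1)%N by rewrite p8.
  have := pN H; case: (N35 H) => N; rewrite N dvdn_prime2 // => /eqP p5.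
    by rewrite p5 in p8.
  (* Here [q = 25], and [25 = 1 + 2 h ^+ 2] has no solution. *)
  exfalso; move: E1; rewrite -Posz_exp (sqr_half p (me H)) N.
  have [r [->|->]] := int_parity h; last by clear; lia.
  by have [r' [->|->]] := int_parity r; clear; lia.
Qed.

Lemma pds_order8 f (x y a' b : int) : q = (8 * f + 1)%N ->
  rep8_xy p m x y -> rep8_ab p m a' b ->
  [/\ is_pds (C 8%N) /\ (odd f -> x = -3 -> a' = 1 -> is_proper_pds (C 8%N))
        <-> [/\ x = a', y = 0 & b = 0],
      [/\ x = a', y = 0 & b = 0] -> forall v k lambda mu : nat,
        pds (C 8%N) v k lambda mu <->
        [/\ v = q,
            k%:R = (q%:R - 1) / 8 :> rat,
            lambda%:R = (q%:R - 23 - 42 * x%:~R) / 64 :> rat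
          & mu%:R = (q%:R - 7 + 6 * x%:~R) / 64 :> rat]
    & [/\ x = a', y = 0 & b = 0] <-> (p %% 8 = 7)%N /\ ~~ odd m].
Proof.
move=> E Rx Ra.
have cF := card_pred cardFp E; have m0 := m_gt0 cardFp.
have op : odd p by apply: (odd_prime_of_odd cardFp); rewrite E; clear; lia.
have : ([\/ p %% 8 = 1, p %% 8 = 3 | p %% 8 = 5] \/ p %% 8 = 7)%N.
  have : (p %% 8 = 1 \/ p %% 8 = 3 \/ p %% 8 = 5 \/ p %% 8 = 7)%N by lia.
  by case=> [|[|[|]]] ->; [left; constructor 1|left; constructor 2|left; constructor
    3|right].
case=> p8.
  have np : ~ (is_pds (C 8%N) /\ (odd f -> x = -3 -> a' = 1 -> is_proper_pds (C 8%N))).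
    case=> P PP; case of_: (odd f); last first.
      by apply: (not_pds_mod8 p_prime cardFp alpha_prim E p8 _ P); rewrite of_.
    have [x3 a1] := odd_pds8_repr E p8 Rx Ra of_ P.
    exact: (improper_odd p_prime cardFp alpha_prim E (erefl : 8 = 2 * 4)%N op of_ (PP
      of_ x3 a1)).
  have ny : ~ [/\ x = a', y = 0 & b = 0].
    case=> _ y0 b0; case: Rx => _ Rx; case: Ra => _ Ra.
    case: p8 => p8; rewrite p8 /= in Ra.
    - have p41 : (p %% 4 == 1)%N by clear -p8; lia.
      rewrite p41 in Rx; case: Rx => Ex px.
      by apply: (repr_neq0 p_prime m0 px (c := 1)); rewrite mul1r Ex y0; ring.
    - case: Ra => Ea pa.
      by apply: (repr_neq0 p_prime m0 pa (c := 1)); rewrite mul1r Ea b0; ring.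
    - have p41 : (p %% 4 == 1)%N by clear -p8; lia.
      rewrite p41 in Rx; case: Rx => Ex px.
      by apply: (repr_neq0 p_prime m0 px (c := 1)); rewrite mul1r Ex y0; ring.
  by split=> //; split=> // -[p7]; rewrite p7 in p8; case: p8.
have me : ~~ odd m.
  by apply/negP => om; have := exp_modN1 m (isT : 1 < 8)%N p8; rewrite om E; clear; lia.
have oN : odd (p ^ m./2)%N by rewrite oddX op orbT.
(* [p ^ m./2] is 1 or 7 modulo 8, so its square [q] is 1 modulo 16. *)
have ef : ~~ odd f.
  have N8 : (p ^ m./2 %% 8 = 1 \/ p ^ m./2 %% 8 = 7)%N.
    by rewrite (exp_modN1 _ (isT : 1 < 8)%N p8); case: (odd _); [right|left].
  have := sqr_half p me; rewrite E; move: (p ^ m./2)%N N8 => N N8 EN.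
  have [k Nk] : exists k, (N = 8 * k + 1 \/ N = 8 * k + 7)%N by exists (N %/ 8)%N;
    clear -N8; lia.
  have [j Ej] : exists j, (N * N = 16 * j + 1)%N.
    by case: Nk => ->; [exists (4 * (k * k) + k)%N|exists (4 * (k * k) + 7 * k +
      3)%N]; ring.
  by rewrite Ej in EN; clear -EN; lia.
have p41 : (p %% 4 == 1)%N = false by clear -p8; lia.
case: Rx => x4; rewrite p41 => -[xN y0].
case: Ra => a4; rewrite p8 /= => -[aN b0].
rewrite -!Posz_exp in xN aN.
have xa : x = a'.
  by clear -x4 a4 xN aN oN; lia.
have [s [zeta [sN zp HA]]] := semiprimitive8 alpha_prim p_prime cardFp me cF p8.
have [P E1 Ea] := semiprimitive_pds alpha_prim cardFp cF isT zp HA.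
(* [64 lambda = q - 23 + 42 s] gives [s = 3] modulo 4, whereas [x = 1]. *)
have ss : s = - x.
  by clear -E1 E sN xN x4; move: E1 sN xN; rewrite E; lia.
split.
- split=> // _; split; first by exists q, f, (diff_mult (C 8) 1), (diff_mult (C 8) a).
  by move=> of_; rewrite of_ in ef.
- move=> _; apply: (pds_params cardFp alpha_prim E isT P).
  + by rewrite E; field.
  + rewrite -(@rat_eq_divn _ (q%:Z - 23 - 42 * x) 64) //; last by clear -E1 ss; lia.
    by field.
  + rewrite -(@rat_eq_divn _ (q%:Z - 7 + 6 * x) 64) //; last by clear -Ea ss; lia.
    by field.
- by [].
Qed.

End Orders468.

Theorem theorem4p3 (p m : nat) (F : finFieldType) (alpha : {unit F})
    (p_prime : prime p) (cardF : #|F| = (p ^ m)%N)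
    (alpha_prim : primitive_element alpha) :
  let q : nat := (p ^ m)%N in
  let C := cyclotomic_class0 alpha in
  [/\ (* (i) *)
      forall (f : nat) (c d : int), q = (3 * f + 1)%N -> rep3 p m c d ->
      [/\ is_pds (C 3%N) <-> d = 0,
          d = 0 -> forall v k lambda mu : nat,
            pds (C 3%N) v k lambda mu <->
            [/\ v = q,
                k%:R = (q%:R - 1) / 3 :> rat,
                lambda%:R = (q%:R - 8 + c%:~R) / 9 :> rat
              & mu%:R = (2 * q%:R - 4 - c%:~R) / 18 :> rat],
          d = 0 -> ~ trivial_pds (C 3%N) -> is_proper_pds (C 3%N)
        & d = 0 <-> (p %% 3 = 2)%N /\ ~~ odd m],
      (* (ii) *)
      forall (f : nat) (s t : int), q = (4 * f + 1)%N -> rep4 p m s t ->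
      [/\ is_pds (C 4%N) /\ (odd f -> s = 1 -> is_proper_pds (C 4%N)) <-> t = 0,
          t = 0 -> forall v k lambda mu : nat,
            pds (C 4%N) v k lambda mu <->
            [/\ v = q,
                k%:R = (q%:R - 1) / 4 :> rat,
                lambda%:R = (q%:R - 11 - 6 * s%:~R) / 16 :> rat
              & mu%:R = (q%:R - 3 + 2 * s%:~R) / 16 :> rat]
        & t = 0 <-> (p %% 4 = 3)%N /\ ~~ odd m],
      (* (iii) *)
      forall (f : nat) (s t : int), q = (6 * f + 1)%N -> rep6 p m s t ->
      [/\ is_pds (C 6%N) /\ (f = 1%N -> is_proper_pds (C 6%N)) <-> t = 0,
          t = 0 -> forall v k lambda mu : nat,
            pds (C 6%N) v k lambda mu <->
            [/\ v = q,
                k%:R = (q%:R - 1) / 6 :> rat,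
                lambda%:R = (q%:R - 17 - 20 * s%:~R) / 36 :> rat
              & mu%:R = (q%:R - 5 + 4 * s%:~R) / 36 :> rat]
        & t = 0 <-> (p %% 6 = 5)%N /\ ~~ odd m]
    & (* (iv) *)
      forall (f : nat) (x y a b : int), q = (8 * f + 1)%N ->
      rep8_xy p m x y -> rep8_ab p m a b ->
      [/\ is_pds (C 8%N) /\ (odd f -> x = -3 -> a = 1 -> is_proper_pds (C 8%N))
            <-> [/\ x = a, y = 0 & b = 0],
          [/\ x = a, y = 0 & b = 0] -> forall v k lambda mu : nat,
            pds (C 8%N) v k lambda mu <->
            [/\ v = q,
                k%:R = (q%:R - 1) / 8 :> rat,
                lambda%:R = (q%:R - 23 - 42 * x%:~R) / 64 :> rat
              & mu%:R = (q%:R - 7 + 6 * x%:~R) / 64 :> rat]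
        & [/\ x = a, y = 0 & b = 0] <-> (p %% 8 = 7)%N /\ ~~ odd m]].
Proof.
move=> q C; split.
- by move=> f c d; apply: pds_order3.
- by move=> f s t; apply: pds_order4.
- by move=> f s t; apply: pds_order6.
- by move=> f x y a b; apply: pds_order8.
Qed.
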